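(* Let $M$ be a closed term. Then $\mathcal{P}(M)=\sup\{\|\mathtt{a}\|\mid \text{there is a tight derivation of } \vdash^{w}M:\mathtt{a} \text{ for some } w\}$ and $\mathcal{E}(M)=\sup\{w\mid \text{there is a tight derivation of } \vdash^{w}M:\mathtt{a}\text{ for some }\mathtt{a}\}$.
   Context: Terms: values $V ::= x \mid \lambda x.M$; terms $M ::= V \mid VV \mid M\oplus M \mid \mathtt{let}\ x = M\ \mathtt{in}\ M$; $M\{V/x\}$ is capture-avoiding substitution. A multidistribution on terms is a finite multiset $\langle p_iM_i\rangle_{i\in I}$ with $p_i\in(0,1]$, $\sum_ip_i\le1$; $\sqcup$ is multiset union and $q\cdot\langle p_iM_i\rangle=\langle (qp_i)M_i\rangle$. One-step reduction: $(\lambda x.M)V\to\langle 1\,M\{V/x\}\rangle$; $\mathtt{let}\ x=V\ \mathtt{in}\ M\to\langle 1\,M\{V/x\}\rangle$; $M\oplus N\to\langle\tfrac12 M,\tfrac12 N\rangle$; if $N\to\langle p_iN_i\rangle_{i\in I}$ then $\mathtt{let}\ x=N\ \mathtt{in}\ M\to\langle p_i(\mathtt{let}\ x=N_i\ \mathtt{in}\ M)\rangle_{i\in I}$. Lifting to multidistributions of closed terms: $\langle p_iM_i\rangle_{i\in I}\Rightarrow\bigsqcup_i p_i\cdot\mathbf{m}_i$ where $\mathbf{m}_i=\langle 1M_i\rangle$ if $M_i$ is a value and $M_i\to\mathbf{m}_i$ otherwise. For closed $M$ let $\langle 1M\rangle=\mathbf{m}_0\Rightarrow\mathbf{m}_1\Rightarrow\cdots$;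 $\mathcal{P}_k(M)$ is the sum of the probabilities of the values occurring in $\mathbf{m}_k$; $\mathcal{P}(M)=\sup_k\mathcal{P}_k(M)$ (probability of termination); $\mathcal{E}_k(M)=\sum_{j=0}^{k-1}(1-\mathcal{P}_j(M))$ and $\mathcal{E}(M)=\sup_k\mathcal{E}_k(M)$ (expected runtime, possibly $\infty$). Types: arrow types $\mathtt{A} ::= \mathcal{M}\to \mathtt{a}$; intersection types $\mathcal{M} ::= [q_1\cdot \mathtt{A}_1,\dots,q_n\cdot\mathtt{A}_n]$ ($n\ge0$, scale factors $q_i\in(0,1]\cap\mathbb{Q}$); type distributions $\mathtt{a} ::= \langle p_1\mathcal{M}_1,\dots,p_n\mathcal{M}_n\rangle$ ($n\ge0$, $p_i\in(0,1]$, $\sum p_i\le1$), with norm $\|\mathtt{a}\|=\sum_i p_i$; $\mathbf{0}$ is the empty type distribution. Scaling: $u\cdot[q_i\cdot\mathtt{A}_i]_i=[(uq_i)\cdot \mathtt{A}_i]_i$, $u\cdot\langle p_i\mathcal{M}_i\rangle_i=\langle (up_i)\mathcal{M}_i\rangle_i$; $\uplus,\sqcup$ multiset unions. Typing contexts map variables to intersection types (finitely many nonempty), pointwise $\uplus$ and scaling. Rules for $\Gamma\vdash^{w}M:\tau$ ($w\in\mathbb{Q}$): (Var) $x:\mathcal{M}\vdash^0 x:\mathcal{M}$. (Zero) $\vdash^0 M:\mathbf{0}$. (@) from $\Gamma\vdash^{w}V:[1\cdot(\mathcal{M}\to\mathtt{b})]$, $\Delta\vdash^{v}W:\mathcal{M}$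 infer $\Gamma\uplus\Delta\vdash^{w+v}VW:\mathtt{b}$. ($\oplus$) from $\Gamma\vdash^{w}M:\mathtt{a}$, $\Delta\vdash^{v}N:\mathtt{b}$ infer $\tfrac12\cdot\Gamma\uplus\tfrac12\cdot\Delta\vdash^{\frac12 w+\frac12 v+1}M\oplus N:\tfrac12\mathtt{a}\sqcup\tfrac12\mathtt{b}$. ($\lambda$) from $\Gamma,x:\mathcal{M}\vdash^{w}M:\mathtt{b}$ infer $\Gamma\vdash^{w+1}\lambda x.M:\mathcal{M}\to\mathtt{b}$. (let) from $\Gamma\vdash^{v}N:\langle p_k\mathcal{M}_k\rangle_{k\in K}$ and $\Delta_k,x:\mathcal{M}_k\vdash^{w_k}M:\mathtt{b}_k$ ($k\in K$) infer $\Gamma\uplus_{k}p_k\cdot\Delta_k\vdash^{\sum_k p_kw_k+v+1}\mathtt{let}\ x=N\ \mathtt{in}\ M:\bigsqcup_k p_k\mathtt{b}_k$. (Val) from $\Gamma\vdash^{w}V:\mathcal{M}$ infer $\Gamma\vdash^{w}V:\langle 1\mathcal{M}\rangle$. (!) for finite possibly empty $I$, from $\Gamma_i\vdash^{w_i}V:\mathtt{A}_i$ and scale factors $q_i$ infer $\uplus_i q_i\cdot\Gamma_i\vdash^{\sum_i q_iw_i}V:[q_i\cdot\mathtt{A}_i]_{i\in I}$. A type distribution is tight if it has the form $\langle q_k[\,]\rangle_{k\in K}$ ($K$ possibly empty); a derivation of $\vdash^{w}M:\mathtt{a}$ (empty context) is tight if $\mathtt{a}$ is tight. *)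

(* Defs.v *)
From HB Require Import structures.
From mathcomp Require Import all_boot all_order all_algebra.
From mathcomp Require Import classical_sets reals ereal.

Set Implicit Arguments.
Unset Strict Implicit.
Unset Printing Implicit Defensive.

Import Order.TTheory GRing.Theory Num.Theory.
Local Open Scope ring_scope.

(** * Terms, up to alpha-equivalence (de Bruijn indices) *)

(* [Lam] binds index 0 in its body; [Let N M] binds index 0 in [M]. *)
Inductive value : Type :=
  | Var : nat -> value
  | Lam : tm -> value
with tm : Type :=
  | Val : value -> tm
  | App : value -> value -> tm
  | Oplus : tm -> tm -> tm
  | Let : tm -> tm -> tm.

Definition scons (T : Type) (x : T) (s : nat -> T) (n : nat) : T :=
  if n is k.+1 then s k else x.

Definition up_ren (xi : nat -> nat) : nat -> nat :=
  scons 0%N (fun n => (xi n).+1).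

Fixpoint vren (xi : nat -> nat) (V : value) : value :=
  match V with
  | Var n => Var (xi n)
  | Lam M => Lam (tren (up_ren xi) M)
  end
with tren (xi : nat -> nat) (M : tm) : tm :=
  match M with
  | Val V => Val (vren xi V)
  | App V W => App (vren xi V) (vren xi W)
  | Oplus M1 M2 => Oplus (tren xi M1) (tren xi M2)
  | Let N M1 => Let (tren xi N) (tren (up_ren xi) M1)
  end.

Definition up_subst (s : nat -> value) : nat -> value :=
  scons (Var 0) (fun n => vren succn (s n)).

Fixpoint vsubst (s : nat -> value) (V : value) : value :=
  match V with
  | Var n => s n
  | Lam M => Lam (tsubst (up_subst s) M)
  end
with tsubst (s : nat -> value) (M : tm) : tm :=
  match M with
  | Val V => Val (vsubst s V)
  | App V W => App (vsubst s V) (vsubst s W)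
  | Oplus M1 M2 => Oplus (tsubst s M1) (tsubst s M2)
  | Let N M1 => Let (tsubst s N) (tsubst (up_subst s) M1)
  end.

(* M{V/x}, where x is the variable of index 0 in M. *)
Definition subst1 (M : tm) (V : value) : tm := tsubst (scons V Var) M.

(* All free variables have index < n. *)
Fixpoint vclosed_at (n : nat) (V : value) : bool :=
  match V with
  | Var k => (k < n)%N
  | Lam M => tclosed_at n.+1 M
  end
with tclosed_at (n : nat) (M : tm) : bool :=
  match M with
  | Val V => vclosed_at n V
  | App V W => vclosed_at n V && vclosed_at n W
  | Oplus M1 M2 => tclosed_at n M1 && tclosed_at n M2
  | Let N M1 => tclosed_at n N && tclosed_at n.+1 M1
  end.

Definition closed_term (M : tm) : bool := tclosed_at 0 M.

Definition is_value (M : tm) : bool := if M is Val _ then true else false.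

(** * Finite multisets with coefficients *)

(* <p_i x_i>_i and [q_i . x_i]_i are lists of pairs (coefficient, element);
   multiset union is concatenation. *)
Definition mscale (F : numFieldType) (T : Type) (u : F) (s : seq (F * T)) :
    seq (F * T) :=
  [seq (u * x.1, x.2) | x <- s].

Definition mass (F : numFieldType) (T : Type) (s : seq (F * T)) : F :=
  \sum_(x <- s) x.1.

(** * Reduction *)

Section Reduction.
Variable F : numFieldType.

Inductive red : tm -> seq (F * tm) -> Prop :=
  | red_beta M V : red (App (Lam M) V) [:: (1, subst1 M V)]
  | red_let V M : red (Let (Val V) M) [:: (1, subst1 M V)]
  | red_oplus M N : red (Oplus M N) [:: (2^-1, M); (2^-1, N)]
  | red_letC N M m : red N m ->
      red (Let N M) [seq (x.1, Let x.2 M) | x <- m].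

Fixpoint step (M : tm) : option (seq (F * tm)) :=
  match M with
  | Val _ => None
  | App (Lam M1) V => Some [:: (1, subst1 M1 V)]
  | App (Var _) _ => None
  | Oplus M1 M2 => Some [:: (2^-1, M1); (2^-1, M2)]
  | Let (Val V) M1 => Some [:: (1, subst1 M1 V)]
  | Let N M1 => omap (fun m => [seq (x.1, Let x.2 M1) | x <- m]) (step N)
  end.

(* Reduction is deterministic: [step] is [red] as a partial function (redP).
   On closed terms it is undefined exactly on values (step_progress). *)
Lemma step_letC (N M : tm) (m : seq (F * tm)) :
  step N = Some m -> step (Let N M) = Some [seq (x.1, Let x.2 M) | x <- m].
Proof.
by case: N => [V|V W|A B|A B] //=; [move=> -> | case=> <- | move=> ->].
Qed.

Lemma redP (M : tm) (m : seq (F * tm)) : red M m <-> step M = Some m.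
Proof.
split; first by elim=> // *; exact: step_letC.
elim: M m => [V|V W|A _ B _|N IHN M1 _] m //.
- by case: V => // M [<-]; constructor.
- by case=> <-; constructor.
- case E: (step N) => [m'|]; last first.
    case: N {IHN} E => [V _ [<-]|V W /= ->|A B|A B /= ->] //; exact: red_let.
  by rewrite (step_letC _ E) => -[<-]; constructor; exact: IHN.
Qed.

Lemma step_progress (M : tm) :
  closed_term M -> ~~ is_value M -> exists m, step M = Some m.
Proof.
rewrite /closed_term.
elim: M => [V|[n|M] W|A _ B _|N IHN M _] //=; try by move=> _ _; eexists.
move=> /andP[cN _] _; case: N cN IHN => [V|V W|A B|A B] cN IHN.
- by eexists.
all: by have [//|//|m stepN] := IHN; eexists; exact: step_letC stepN.
Qed.

Definition tnext (M : tm) : seq (F * tm) :=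
  if step M is Some m then m else [:: (1, M)].

Definition mlift (m : seq (F * tm)) : seq (F * tm) :=
  flatten [seq mscale x.1 (tnext x.2) | x <- m].

Definition run (k : nat) (M : tm) : seq (F * tm) := iter k mlift [:: (1, M)].

(* P_k(M) and E_k(M) *)
Definition Pk (k : nat) (M : tm) : F := \sum_(x <- run k M | is_value x.2) x.1.
Definition Ek (k : nat) (M : tm) : F := \sum_(j < k) (1 - Pk j M).

End Reduction.

Section Suprema.
Variable R : realType.
Local Open Scope classical_set_scope.

Definition prob_term (M : tm) : \bar R :=
  ereal_sup (range (fun k => (Pk R k M)%:E)).
Definition exp_time (M : tm) : \bar R :=
  ereal_sup (range (fun k => (Ek R k M)%:E)).

End Suprema.

(** * Types *)

Inductive arrow : Type :=
  Arr : seq (rat * arrow) -> seq (rat * seq (rat * arrow)) -> arrow.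

Notation itype := (seq (rat * arrow)).
Notation dtype := (seq (rat * itype)).

(* Equality of multisets represented as lists: the least equivalence
   generated by permutations and by [E] on elements. *)
Inductive mset_eq (T : Type) (E : T -> T -> Prop) :
    seq (rat * T) -> seq (rat * T) -> Prop :=
  | mset_eq_nil : mset_eq E [::] [::]
  | mset_eq_skip q x y s t :
      E x y -> mset_eq E s t -> mset_eq E ((q, x) :: s) ((q, y) :: t)
  | mset_eq_swap x y s : mset_eq E (x :: y :: s) (y :: x :: s)
  | mset_eq_trans s t u : mset_eq E s t -> mset_eq E t u -> mset_eq E s u.

Inductive arrow_eq : arrow -> arrow -> Prop :=
  ArrEq m m' a a' :
    mset_eq arrow_eq m m' -> mset_eq (mset_eq arrow_eq) a a' ->
    arrow_eq (Arr m a) (Arr m' a').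

Notation itype_eq := (mset_eq arrow_eq).
Notation dtype_eq := (mset_eq itype_eq).

(* The grammar of types constrains the coefficients of the raw types above. *)
Definition coef_ok (q : rat) : bool := 0 < q <= 1.
Definition coefs_wf (T : Type) (P : T -> bool) (s : seq (rat * T)) : bool :=
  all (fun x => coef_ok x.1 && P x.2) s.

Fixpoint arrow_wf (A : arrow) : bool :=
  let: Arr m a := A in
  [&& coefs_wf arrow_wf m, coefs_wf (coefs_wf arrow_wf) a & mass a <= 1].
Definition itype_wf (m : itype) : bool := coefs_wf arrow_wf m.

Definition tight (a : dtype) : bool := all (fun x => nilp x.2) a.

(** * Typing contexts *)

Notation ctx := (nat -> itype).

Definition ctx0 : ctx := fun _ => [::].
Definition ctx1 (x : nat) (m : itype) : ctx :=
  fun y => if y == x then m else [::].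
Definition ctx_add (G D : ctx) : ctx := fun x => G x ++ D x.
Definition ctx_scale (u : rat) (G : ctx) : ctx := fun x => mscale u (G x).
Definition ctx_sum (n : nat) (G : 'I_n -> ctx) : ctx :=
  fun x => flatten [seq G i x | i : 'I_n].
Definition ctx_eq (G D : ctx) : Prop := forall x, itype_eq (G x) (D x).

(** * Type assignment *)

(* Three judgements, for values with arrow types, values with intersection
   types, and terms with type distributions. The context Gamma, x : m under a
   binder is [scons m Gamma]. The rules [.._eq] only identify different lists
   that represent the same multisets. The side conditions of [ty_var] and
   [ty_bang] make all types in a derivation well-formed. *)
Inductive tyA : ctx -> rat -> value -> arrow -> Prop :=
  | ty_lam G w M m b :
      tyD (scons m G) w M b -> tyA G (w + 1) (Lam M) (Arr m b)
  | tyA_eq G G' w V A A' :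
      ctx_eq G G' -> arrow_eq A A' -> tyA G w V A -> tyA G' w V A'
with tyI : ctx -> rat -> value -> itype -> Prop :=
  | ty_var x m : itype_wf m -> tyI (ctx1 x m) 0 (Var x) m
  | ty_bang n (q : 'I_n -> rat) (G : 'I_n -> ctx) (w : 'I_n -> rat) V
      (A : 'I_n -> arrow) :
      (forall i, coef_ok (q i)) ->
      (forall i, tyA (G i) (w i) V (A i)) ->
      tyI (ctx_sum (fun i => ctx_scale (q i) (G i)))
          (\sum_(i < n) q i * w i) V [seq (q i, A i) | i : 'I_n]
  | tyI_eq G G' w V m m' :
      ctx_eq G G' -> itype_eq m m' -> tyI G w V m -> tyI G' w V m'
with tyD : ctx -> rat -> tm -> dtype -> Prop :=
  | ty_zero M : tyD ctx0 0 M [::]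
  | ty_app G D w v V W m b :
      tyI G w V [:: (1, Arr m b)] -> tyI D v W m ->
      tyD (ctx_add G D) (w + v) (App V W) b
  | ty_oplus G D w v M N a b :
      tyD G w M a -> tyD D v N b ->
      tyD (ctx_add (ctx_scale 2^-1 G) (ctx_scale 2^-1 D))
          (2^-1 * w + 2^-1 * v + 1) (Oplus M N)
          (mscale 2^-1 a ++ mscale 2^-1 b)
  | ty_let n (p : 'I_n -> rat) (m : 'I_n -> itype) (D : 'I_n -> ctx)
      (w : 'I_n -> rat) (b : 'I_n -> dtype) G v N M :
      tyD G v N [seq (p k, m k) | k : 'I_n] ->
      (forall k, tyD (scons (m k) (D k)) (w k) M (b k)) ->
      tyD (ctx_add G (ctx_sum (fun k => ctx_scale (p k) (D k))))
          (\sum_(k < n) p k * w k + v + 1) (Let N M)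
          (flatten [seq mscale (p k) (b k) | k : 'I_n])
  | ty_val G w V m : tyI G w V m -> tyD G w (Val V) [:: (1, m)]
  | tyD_eq G G' w M a a' :
      ctx_eq G G' -> dtype_eq a a' -> tyD G w M a -> tyD G' w M a'.

Definition tight_typing (w : rat) (M : tm) (a : dtype) : Prop :=
  tyD ctx0 w M a /\ tight a.

(* Main.v *)
Require Import Defs.
From mathcomp Require Import all_boot all_order all_algebra.
From mathcomp Require Import classical_sets reals ereal.
From mathcomp Require Import ring lra.

Set Implicit Arguments.
Unset Strict Implicit.
Unset Printing Implicit Defensive.

Import Order.TTheory GRing.Theory Num.Theory.
Local Open Scope ring_scope.
Local Open Scope classical_set_scope.

(* Soundness is proved by realizability: a closed value realizes [m -> b] with
   potential [w] if applying it to any realizer of [m] unfolds, by a finite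
   evaluation tree, to values realizing [b], the potentials paying for the
   steps of the tree. A tight type leaves no potential at the leaves, so the
   tree itself bounds [w] and the norm by some E_k and P_k. Completeness is
   subject expansion: only closed values are ever substituted, so a typing of
   M{V/x} splits into a typing of M and one of V. Since (Zero) may type a
   let-expression with weight 0, expansion only bounds the weight from below,
   and E_k, P_k are dominated by tight derivations, by induction on k. All of
   this takes place over the rationals. *)

(** * Substitution of closed values *)

(* The delicate rule is (let): it charges 1 even if N reaches values with total probability below 1.
   The charge is still honest, because a branch cut before a value carries a closed let-expression
   that can make one more step; the probabilities of a step sum to 1, so the charge is one step on
   average. The same identity, read backwards, merges the lets of the branches of a reduct into one
   let. Potentials are tracked by equations, not inequalities: splitting and scaling contexts become
   linear identities, and an empty intersection type holds exactly potential 0. Realizability is a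
   structural recursion on types, so it needs no step index; finiteness of the tree comes from the
   type. Multisets are lists, so every relation has to be stable under nested permutations, and
   [arrow_eq] and [ev] are nested inductives whose generated induction principles are too weak;
   hence the hand-written fixpoints. *)
Scheme value_mind := Induction for value Sort Prop
  with tm_mind := Induction for tm Sort Prop.
Combined Scheme value_tm_ind from value_mind, tm_mind.

Lemma ren_id :
  (forall V n xi, vclosed_at n V -> (forall x, (x < n)%N -> xi x = x) ->
     vren xi V = V) /\
  (forall M n xi, tclosed_at n M -> (forall x, (x < n)%N -> xi x = x) ->
     tren xi M = M).
Proof.
have up_fix n xi : (forall x, (x < n)%N -> xi x = x) ->
    forall x, (x < n.+1)%N -> up_ren xi x = x.
  by move=> h [|x] //= /h ->.
apply: value_tm_ind => /=.
- by move=> k n xi ck h; rewrite h.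
- by move=> M IH n xi /IH h /up_fix/h ->.
- by move=> V IH n xi /IH h /h ->.
- by move=> V IHV W IHW n xi /andP[/IHV hV /IHW hW] h; rewrite hV ?hW.
- by move=> M IHM N IHN n xi /andP[/IHM hM /IHN hN] h; rewrite hM ?hN.
- move=> N IHN M IHM n xi /andP[/IHN hN /IHM hM] h.
  by rewrite hN // hM //; exact: up_fix.
Qed.

Lemma vren_closed xi V : vclosed_at 0 V -> vren xi V = V.
Proof. by move=> cV; exact: (ren_id.1 V 0%N). Qed.

Lemma subst_ext :
  (forall V n s t, vclosed_at n V -> (forall x, (x < n)%N -> s x = t x) ->
     vsubst s V = vsubst t V) /\
  (forall M n s t, tclosed_at n M -> (forall x, (x < n)%N -> s x = t x) ->
     tsubst s M = tsubst t M).
Proof.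
have up_ext n s t : (forall x, (x < n)%N -> s x = t x) ->
    forall x, (x < n.+1)%N -> up_subst s x = up_subst t x.
  by move=> h [|x] //= /h ->.
apply: value_tm_ind => /=.
- by move=> k n s t ck h; rewrite h.
- by move=> M IH n s t /IH h /up_ext/h ->.
- by move=> V IH n s t /IH h /h ->.
- move=> V IHV W IHW n s t /andP[/IHV hV /IHW hW] h.
  by rewrite (hV s t) ?(hW s t).
- move=> M IHM N IHN n s t /andP[/IHM hM /IHN hN] h.
  by rewrite (hM s t) ?(hN s t).
- move=> N IHN M IHM n s t /andP[/IHN hN /IHM hM] h.
  by rewrite (hN s t) // (hM _ (up_subst t)) //; exact: up_ext.
Qed.

Lemma subst_id :
  (forall V n s, vclosed_at n V -> (forall x, (x < n)%N -> s x = Var x) ->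
     vsubst s V = V) /\
  (forall M n s, tclosed_at n M -> (forall x, (x < n)%N -> s x = Var x) ->
     tsubst s M = M).
Proof.
have up_id n s : (forall x, (x < n)%N -> s x = Var x) ->
    forall x, (x < n.+1)%N -> up_subst s x = Var x.
  by move=> h [|x] //= /h ->.
apply: value_tm_ind => /=.
- by move=> k n s ck h; rewrite h.
- by move=> M IH n s /IH h /up_id/h ->.
- by move=> V IH n s /IH h /h ->.
- by move=> V IHV W IHW n s /andP[/IHV hV /IHW hW] h; rewrite hV ?hW.
- by move=> M IHM N IHN n s /andP[/IHM hM /IHN hN] h; rewrite hM ?hN.
- move=> N IHN M IHM n s /andP[/IHN hN /IHM hM] h.
  by rewrite hN // hM //; exact: up_id.
Qed.

Lemma vsubst_closed s V : vclosed_at 0 V -> vsubst s V = V.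
Proof. by move=> cV; exact: (subst_id.1 V 0%N). Qed.

Lemma tsubst_closed s M : tclosed_at 0 M -> tsubst s M = M.
Proof. by move=> cM; exact: (subst_id.2 M 0%N). Qed.

Lemma closed_le :
  (forall V n m, vclosed_at n V -> (n <= m)%N -> vclosed_at m V) /\
  (forall M n m, tclosed_at n M -> (n <= m)%N -> tclosed_at m M).
Proof.
apply: value_tm_ind => /=.
- by move=> k n m lt_kn; exact: leq_trans.
- by move=> M IH n m /IH h le_nm; exact: h.
- by move=> V IH n m /IH h; exact: h.
- by move=> V IHV W IHW n m /andP[/IHV hV /IHW hW] le_nm; rewrite hV ?hW.
- by move=> M IHM N IHN n m /andP[/IHM hM /IHN hN] le_nm; rewrite hM ?hN.
- by move=> N IHN M IHM n m /andP[/IHN hN /IHM hM] le_nm; rewrite hN ?hM.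
Qed.

Lemma closed_ren :
  (forall V n m xi, vclosed_at n V -> (forall x, (x < n)%N -> (xi x < m)%N) ->
     vclosed_at m (vren xi V)) /\
  (forall M n m xi, tclosed_at n M -> (forall x, (x < n)%N -> (xi x < m)%N) ->
     tclosed_at m (tren xi M)).
Proof.
have up_lt n m xi : (forall x, (x < n)%N -> (xi x < m)%N) ->
    forall x, (x < n.+1)%N -> (up_ren xi x < m.+1)%N.
  by move=> h [|x] //= /h.
apply: value_tm_ind => /=.
- by move=> k n m xi ck; exact.
- by move=> M IH n m xi /IH h /up_lt; exact: h.
- by move=> V IH n m xi /IH; exact.
- move=> V IHV W IHW n m xi /andP[/IHV hV /IHW hW] h.
  by rewrite hV ?hW.
- move=> M IHM N IHN n m xi /andP[/IHM hM /IHN hN] h.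
  by rewrite hM ?hN.
- move=> N IHN M IHM n m xi /andP[/IHN hN /IHM hM] h.
  by rewrite hN // hM //; exact: up_lt.
Qed.

Lemma closed_subst :
  (forall V n m s, vclosed_at n V ->
     (forall x, (x < n)%N -> vclosed_at m (s x)) -> vclosed_at m (vsubst s V)) /\
  (forall M n m s, tclosed_at n M ->
     (forall x, (x < n)%N -> vclosed_at m (s x)) -> tclosed_at m (tsubst s M)).
Proof.
have up_cl n m s : (forall x, (x < n)%N -> vclosed_at m (s x)) ->
    forall x, (x < n.+1)%N -> vclosed_at m.+1 (up_subst s x).
  move=> h [|x] //= /h cx; exact: (closed_ren.1 _ m).
apply: value_tm_ind => /=.
- by move=> k n m s ck; exact.
- by move=> M IH n m s /IH h /up_cl; exact: h.
- by move=> V IH n m s /IH; exact.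
- move=> V IHV W IHW n m s /andP[/IHV hV /IHW hW] h.
  by rewrite hV ?hW.
- move=> M IHM N IHN n m s /andP[/IHM hM /IHN hN] h.
  by rewrite hM ?hN.
- move=> N IHN M IHM n m s /andP[/IHN hN /IHM hM] h.
  by rewrite hN // hM //; exact: up_cl.
Qed.

Lemma closed_subst1 M V :
  tclosed_at 1 M -> vclosed_at 0 V -> tclosed_at 0 (subst1 M V).
Proof. by move=> cM cV; apply: (closed_subst.2 _ 1%N) => // -[]. Qed.

(** The images of every substitution that is composed here, at any binder depth. On this shape
    lifting commutes with substitution at once, so composition needs no general theory of
    renaming. *)
Definition var_or_closed (V : value) : Prop :=
  (exists x, V = Var x) \/ vclosed_at 0 V.

Lemma subst_comp :
  (forall V n s t r, vclosed_at n V ->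
     (forall x, (x < n)%N -> var_or_closed (s x) /\ vsubst t (s x) = r x) ->
     vsubst t (vsubst s V) = vsubst r V) /\
  (forall M n s t r, tclosed_at n M ->
     (forall x, (x < n)%N -> var_or_closed (s x) /\ vsubst t (s x) = r x) ->
     tsubst t (tsubst s M) = tsubst r M).
Proof.
have up_comp n s t r :
    (forall x, (x < n)%N -> var_or_closed (s x) /\ vsubst t (s x) = r x) ->
    forall x, (x < n.+1)%N -> var_or_closed (up_subst s x) /\
      vsubst (up_subst t) (up_subst s x) = up_subst r x.
  move=> h [|x] /=; first by split => //; left; exists 0%N.
  move=> /h[[[y ->]|cs] <-] /=; first by split => //; left; exists y.+1.
  by rewrite !vren_closed ?vsubst_closed //; split => //; right.
apply: value_tm_ind => /=.
- by move=> k n s t r ck /(_ _ ck)[].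
- by move=> M IH n s t r /IH h /up_comp/h ->.
- by move=> V IH n s t r /IH h /h ->.
- move=> V IHV W IHW n s t r /andP[/IHV hV /IHW hW] h.
  by rewrite (hV _ _ r) // (hW _ _ r).
- move=> M IHM N IHN n s t r /andP[/IHM hM /IHN hN] h.
  by rewrite (hM _ _ r) // (hN _ _ r).
- move=> N IHN M IHM n s t r /andP[/IHN hN /IHM hM] h.
  by rewrite (hN _ _ r) // (hM _ _ (up_subst r)) //; exact: up_comp.
Qed.

Lemma step_closed (F : numFieldType) M (ms : seq (F * tm)) :
  closed_term M -> step F M = Some ms -> all (fun x => closed_term x.2) ms.
Proof.
rewrite /closed_term => cM /redP r; elim: r cM => {M ms} /=.
- by move=> M V /andP[cM cV]; rewrite closed_subst1.
- by move=> V M /andP[cV cM]; rewrite closed_subst1.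
- by move=> M N /andP[-> ->].
- move=> N M m _ IH /andP[/IH cm cM]; rewrite all_map.
  by apply: sub_all cm => x /= ->.
Qed.

Lemma step_mass (F : numFieldType) M (ms : seq (F * tm)) :
  step F M = Some ms -> mass ms = 1.
Proof.
move=> /redP; elim => {M ms} *; rewrite /mass ?big_cons ?big_nil /= ?addr0 //.
- by field.
- by rewrite big_map.
Qed.

Lemma step_gt0 (F : numFieldType) M (ms : seq (F * tm)) :
  step F M = Some ms -> all (fun x => 0 < x.1) ms.
Proof.
move=> /redP; elim => {M ms} /=.
- by move=> *; rewrite ltr01.
- by move=> *; rewrite ltr01.
- by move=> *; rewrite invr_gt0 ltr0n.
- by move=> N M m _; rewrite all_map.
Qed.

Lemma step_nval (F : numFieldType) M (ms : seq (F * tm)) :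
  step F M = Some ms -> is_value M = false.
Proof. by case: M. Qed.

(** * Termination probability and runtime after one step *)

Section Runs.
Variable F : numFieldType.
Implicit Types (M : tm) (s ms : seq (F * tm)).

Lemma mscale_cat T u (s t : seq (F * T)) :
  mscale u (s ++ t) = mscale u s ++ mscale u t.
Proof. exact: map_cat. Qed.

Lemma mscale_mscale T u v (s : seq (F * T)) :
  mscale u (mscale v s) = mscale (u * v) s.
Proof. by rewrite /mscale -map_comp; apply: eq_map => x /=; rewrite mulrA. Qed.

Lemma mscale1 T (s : seq (F * T)) : mscale 1 s = s.
Proof. by elim: s => //= -[p x] s ->; rewrite mul1r. Qed.

Lemma mass_cat T (s t : seq (F * T)) : mass (s ++ t) = mass s + mass t.
Proof. by rewrite /mass big_cat. Qed.

Lemma mass_scale T u (s : seq (F * T)) : mass (mscale u s) = u * mass s.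
Proof. by rewrite /mass big_map /= mulr_sumr. Qed.

Lemma mlift_cat s t : mlift (F:=F) (s ++ t) = mlift s ++ mlift t.
Proof. by rewrite /mlift map_cat flatten_cat. Qed.

Lemma mlift_scale u s : mlift (mscale u s) = mscale u (mlift s).
Proof.
elim: s => //= -[p M] s IH.
by rewrite /mlift /= -/(mlift _) IH mscale_cat mscale_mscale.
Qed.

Lemma iter_mlift_cons k p M s :
  iter k (@mlift F) ((p, M) :: s) = mscale p (run F k M) ++ iter k (@mlift F) s.
Proof.
rewrite /run; elim: k => [|k IH] /=; first by rewrite mulr1.
by rewrite IH mlift_cat mlift_scale.
Qed.

Lemma iter_mlift_nil k : iter k (@mlift F) [::] = [::].
Proof. by elim: k => //= k ->. Qed.

Lemma Pk0 M : Pk F 0 M = (is_value M)%:R.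
Proof. by rewrite /Pk /run /= big_cons big_nil /=; case: ifP; rewrite ?addr0. Qed.

(** Peels off the first step rather than the last, by linearity of the lifting; later arguments can
    then go by induction on [k] for all terms at once. *)
Lemma PkS k M : Pk F k.+1 M = \sum_(x <- tnext F M) x.1 * Pk F k x.2.
Proof.
rewrite /Pk /run iterSr /mlift /= cats0 mscale1.
elim: (tnext F M) => [|[p N] s IH]; first by rewrite iter_mlift_nil !big_nil.
rewrite iter_mlift_cons big_cat big_cons IH; congr (_ + _).
by rewrite big_map mulr_sumr.
Qed.

Lemma PkS_step k M ms :
  step F M = Some ms -> Pk F k.+1 M = \sum_(x <- ms) x.1 * Pk F k x.2.
Proof. by move=> h; rewrite PkS /tnext h. Qed.

Lemma Pk_val k V : Pk F k (Val V) = 1.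
Proof.
elim: k => [|k IH]; first by rewrite Pk0.
by rewrite PkS /tnext /= big_cons big_nil /= IH mulr1 addr0.
Qed.

(** The summand for j = 0 is 1, since a term that steps is not a value. In the others 1 is written
    as the mass of the step, so that the difference distributes over the branches. *)
Lemma EkS k M ms : step F M = Some ms ->
  Ek F k.+1 M = 1 + \sum_(x <- ms) x.1 * Ek F k x.2.
Proof.
move=> h; rewrite /Ek big_ord_recl Pk0 (step_nval h) subr0; congr (_ + _).
rewrite (eq_bigr (fun j : 'I_k => \sum_(x <- ms) x.1 * (1 - Pk F j x.2))).
  by rewrite exchange_big; apply: eq_bigr => x _; rewrite mulr_sumr.
move=> j _; rewrite lift0 (PkS_step _ h) -{1}(step_mass h) /mass -sumrB.
by apply: eq_bigr => x _; rewrite mulrBr mulr1.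
Qed.

Lemma Ek_val k V : Ek F k (Val V) = 0.
Proof. by rewrite /Ek big1 // => j _; rewrite Pk_val subrr. Qed.

Lemma ler_sum_step M ms (f g : tm -> F) : step F M = Some ms ->
  (forall N, f N <= g N) ->
  \sum_(x <- ms) x.1 * f x.2 <= \sum_(x <- ms) x.1 * g x.2.
Proof.
move=> /step_gt0 pos le_fg; elim: ms pos => [|x s IH] /=; first by rewrite !big_nil.
move=> /andP[px /IH le_s]; rewrite !big_cons lerD //.
by apply: ler_wpM2l; [exact: ltW|exact: le_fg].
Qed.

Lemma Pk_ge0 k M : 0 <= Pk F k M.
Proof.
elim: k M => [|k IH] M; first by rewrite Pk0 ler0n.
case h: (step F M) => [ms|]; last first.
  by rewrite PkS /tnext h big_cons big_nil /= mul1r addr0.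
rewrite (PkS_step _ h).
apply: le_trans (ler_sum_step (f := fun=> 0) h IH).
by rewrite big1 // => x _; rewrite mulr0.
Qed.

Lemma Pk_le1 k M : Pk F k M <= 1.
Proof.
elim: k M => [|k IH] M; first by rewrite Pk0; case: is_value.
case h: (step F M) => [ms|]; last first.
  by rewrite PkS /tnext h big_cons big_nil /= mul1r addr0.
rewrite (PkS_step _ h).
apply: le_trans (ler_sum_step (g := fun=> 1) h IH) _.
by under eq_bigr do rewrite mulr1; rewrite -/(mass ms) (step_mass h).
Qed.

Lemma PkS_ge k M : Pk F k M <= Pk F k.+1 M.
Proof.
elim: k M => [|k IH] M.
  rewrite Pk0; case: M => [V|V W|A B|A B]; rewrite ?Pk_ge0 //.
  by rewrite Pk_val.
case h: (step F M) => [ms|]; first by rewrite !(PkS_step _ h); exact: ler_sum_step h IH.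
by rewrite !(PkS _ M) /tnext h !big_cons !big_nil /= !mul1r !addr0.
Qed.

Lemma EkS_ge k M : Ek F k M <= Ek F k.+1 M.
Proof. by rewrite /Ek big_ord_recr /= lerDl subr_ge0 Pk_le1. Qed.

Lemma Pk_mono k j M : (k <= j)%N -> Pk F k M <= Pk F j M.
Proof.
move=> /subnK <-; elim: (j - k)%N => // n IH.
by rewrite addSn; apply: le_trans IH (PkS_ge _ _).
Qed.

Lemma Ek_mono k j M : (k <= j)%N -> Ek F k M <= Ek F j M.
Proof.
move=> /subnK <-; elim: (j - k)%N => // n IH.
by rewrite addSn; apply: le_trans IH (EkS_ge _ _).
Qed.

Lemma Ek_ge0 k M : 0 <= Ek F k M.
Proof. by apply: sumr_ge0 => j _; rewrite subr_ge0 Pk_le1. Qed.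

End Runs.

(** * Transfer of runs from rational to real coefficients *)

Section RatRuns.
Variable R : realType.

Let ratr_pair (T : Type) (x : rat * T) : R * T := (ratr x.1, x.2).

Lemma step_ratr M : step R M = omap (map (@ratr_pair tm)) (step rat M).
Proof.
elim: M => [V|[n|M] V|A _ B _|N IH M _] //=.
- by rewrite /ratr_pair /= rmorph1.
- by rewrite /ratr_pair /= fmorphV rmorph_nat.
have E : omap (fun m : seq (R * tm) => [seq (x.1, Let x.2 M) | x <- m])
    (step R N) = omap (map (@ratr_pair tm))
    (omap (fun m : seq (rat * tm) => [seq (x.1, Let x.2 M) | x <- m])
       (step rat N)).
  by rewrite IH; case: (step rat N) => //= m; rewrite -!map_comp.
case: N IH E => [V|V W|A B|A B] IH E //=.
by rewrite /ratr_pair /= rmorph1.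
Qed.

Lemma run_ratr k M : run R k M = map (@ratr_pair tm) (run rat k M).
Proof.
have scale u (s : seq (rat * tm)) :
    mscale (ratr u) (map (@ratr_pair tm) s) = map (@ratr_pair tm) (mscale u s).
  rewrite /mscale -!map_comp; apply: eq_map => x /=.
  by rewrite /ratr_pair /= rmorphM.
have lift s : mlift (map (@ratr_pair tm) s) = map (@ratr_pair tm) (mlift s).
  elim: s => //= -[p N] s IH; rewrite /mlift /= -!/(mlift _) IH map_cat.
  congr (_ ++ _); rewrite -scale; congr mscale.
  by rewrite /tnext step_ratr; case: (step rat N) => //=; rewrite /ratr_pair rmorph1.
rewrite /run; elim: k => [|k IH] /=; first by rewrite /ratr_pair rmorph1.
by rewrite IH lift.
Qed.

Lemma Pk_ratr k M : Pk R k M = ratr (Pk rat k M).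
Proof. by rewrite /Pk run_ratr big_map rmorph_sum. Qed.

Lemma Ek_ratr k M : Ek R k M = ratr (Ek rat k M).
Proof.
rewrite /Ek rmorph_sum; apply: eq_bigr => j _.
by rewrite rmorphB rmorph1 /= -Pk_ratr.
Qed.

End RatRuns.

(** * Multiset equality *)

Section MsetEq.
Variable T : Type.
Implicit Types (E : T -> T -> Prop) (s t : seq (rat * T)).

(* A fixpoint, not a proof by induction tactic: it is used as a nested
   recursive call in [arrow_eq_nested_ind]. *)
Definition mset_eq_mono E E' (sub : forall x y, E x y -> E' x y) :=
  fix mono s t (h : mset_eq E s t) {struct h} : mset_eq E' s t :=
    match h with
    | mset_eq_nil => mset_eq_nil E'
    | mset_eq_skip q _ _ _ _ e h' => mset_eq_skip q (sub _ _ e) (mono _ _ h')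
    | mset_eq_swap x y s => mset_eq_swap E' x y s
    | mset_eq_trans _ _ _ h1 h2 => mset_eq_trans (mono _ _ h1) (mono _ _ h2)
    end.

Lemma mset_eq_refl E s : (forall x, E x x) -> mset_eq E s s.
Proof. by move=> r; elim: s => [|[q x] s IH]; constructor. Qed.

(** Two relations, because inside a nested induction the hypothesis already relates the elements in
    reversed order. *)
Lemma mset_eq_sym E E' s t :
  (forall x y, E x y -> E' y x) -> mset_eq E s t -> mset_eq E' t s.
Proof.
move=> sub; elim => [|q x y s' t' /sub e _ h|x y s'|s' t' u _ h1 _ h2].
- by constructor.
- exact: mset_eq_skip.
- exact: mset_eq_swap.
- exact: mset_eq_trans h2 h1.
Qed.

Lemma mset_eq_cat E s s' t t' : (forall x, E x x) ->
  mset_eq E s s' -> mset_eq E t t' -> mset_eq E (s ++ t) (s' ++ t').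
Proof.
move=> r h ht; have l u : mset_eq E (u ++ t) (u ++ t').
  by elim: u => //= -[q x] u IH; exact: mset_eq_skip.
apply: mset_eq_trans (l s) _ => {l ht}.
elim: h => //= {s s'}.
- exact: mset_eq_refl.
- by move=> q x y s s' e _; exact: mset_eq_skip.
- by move=> x y s; exact: mset_eq_swap.
- by move=> s1 s2 s3 _ h1 _; exact: mset_eq_trans.
Qed.

Lemma mset_eq_scale E u s t :
  mset_eq E s t -> mset_eq E (mscale u s) (mscale u t).
Proof.
elim => //= {s t}; try by constructor.
by move=> s t r _ h1 _ h2; exact: mset_eq_trans h1 h2.
Qed.

Lemma mset_eq_catCA E s t u : (forall x, E x x) ->
  mset_eq E (s ++ t ++ u) (t ++ s ++ u).
Proof.
move=> r; have swap x v w : mset_eq E (x :: v ++ w) (v ++ x :: w).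
  elim: v => [|[q y] v IH] /=; first exact: mset_eq_refl.
  by apply: mset_eq_trans (mset_eq_swap _ _ _ _) _; exact: mset_eq_skip.
elim: s => [|[q x] s IH] /=; first exact: mset_eq_refl.
by apply: mset_eq_trans (swap _ _ _); exact: mset_eq_skip.
Qed.

Lemma mset_eq_nilp E s t : mset_eq E s t -> nilp s = nilp t.
Proof. by elim => // s' t' u _ -> _ ->. Qed.

Lemma mset_eq_mass E s t : mset_eq E s t -> mass s = mass t.
Proof.
elim => // {s t}.
- by move=> q x y s t _ _; rewrite /mass !big_cons => ->.
- by move=> x y s; rewrite /mass !big_cons addrCA.
- by move=> s t u _ -> _ ->.
Qed.

Lemma mset_eq_coefs E (P : T -> bool) s t :
  mset_eq E s t -> (forall x y, E x y -> P x = P y) ->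
  coefs_wf P s = coefs_wf P t.
Proof.
move=> h eP; rewrite /coefs_wf; elim: h => //= {s t}.
- by move=> q x y s t /eP -> _ ->.
- by move=> x y s; rewrite andbCA.
- by move=> s t u _ -> _ ->.
Qed.

End MsetEq.

Lemma mset_eq_flatten (T : Type) (E : T -> T -> Prop) (I : Type) (r : seq I)
    (f g : I -> seq (rat * T)) : (forall x, E x x) ->
  (forall i, mset_eq E (f i) (g i)) ->
  mset_eq E (flatten (map f r)) (flatten (map g r)).
Proof.
move=> re h; elim: r => [|i r IH] /=; first exact: mset_eq_nil.
exact: mset_eq_cat.
Qed.

(** * Bind on weighted lists *)

(* Each element [x] of [s] is replaced by some outcome [l] at some cost [w]
   with [P w x l]; [bindR P w s l] holds for the expected cost and the
   weighted union of the outcomes. *)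
Inductive bindR (T U : Type) (P : rat -> T -> seq (rat * U) -> Prop) :
    rat -> seq (rat * T) -> seq (rat * U) -> Prop :=
  | bindR_nil : bindR P 0 [::] [::]
  | bindR_cons p x s w l w' l' : P w x l -> bindR P w' s l' ->
      bindR P (p * w + w') ((p, x) :: s) (mscale p l ++ l').

(** A transparent fixpoint, like [mset_eq_mono]: the recursive call of [ev_nested_ind] passes
    through it. *)
Definition bindR_mono T U (P Q : rat -> T -> seq (rat * U) -> Prop)
    (sub : forall w x l, P w x l -> Q w x l) :=
  fix mono w s l (h : bindR P w s l) {struct h} : bindR Q w s l :=
    match h with
    | bindR_nil => bindR_nil Q
    | bindR_cons p _ _ _ _ _ _ hP h' => bindR_cons p (sub _ _ _ hP) (mono _ _ _ h')
    end.

Section BindR.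
Variables (T U : Type) (P : rat -> T -> seq (rat * U) -> Prop).
Implicit Types (s : seq (rat * T)) (l : seq (rat * U)).

Lemma bindR_one p w x l : P w x l -> bindR P (p * w) [:: (p, x)] (mscale p l).
Proof.
move=> h; rewrite -[p * w]addr0 -[mscale p l]cats0.
exact: bindR_cons h (bindR_nil P).
Qed.

Lemma bindR_nil_inv w l : bindR P w [::] l -> w = 0 /\ l = [::].
Proof. by move=> h; inversion h. Qed.

Lemma bindR_cons_inv p x s w l : bindR P w ((p, x) :: s) l ->
  exists w1 l1 w2 l2, [/\ P w1 x l1, bindR P w2 s l2, w = p * w1 + w2
                        & l = mscale p l1 ++ l2].
Proof. by move=> h; inversion h; subst; do 4 eexists; split; eauto. Qed.

Lemma bindR_one_inv p x w l : bindR P w [:: (p, x)] l ->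
  exists w1 l1, [/\ P w1 x l1, w = p * w1 & l = mscale p l1].
Proof.
move=> /bindR_cons_inv[w1 [l1 [_ [_ [h /bindR_nil_inv[-> ->] -> ->]]]]].
by exists w1, l1; rewrite addr0 cats0.
Qed.

Lemma bindR_cat w s l w' s' l' : bindR P w s l -> bindR P w' s' l' ->
  bindR P (w + w') (s ++ s') (l ++ l').
Proof.
move=> h h'; elim: h => [|p x s0 w0 l0 w1 l1 hP _ IH] /=; first by rewrite add0r.
by rewrite -addrA -catA; exact: bindR_cons.
Qed.

Lemma bindR_cat_inv w s s' l : bindR P w (s ++ s') l ->
  exists w1 l1 w2 l2, [/\ bindR P w1 s l1, bindR P w2 s' l2, w = w1 + w2
                        & l = l1 ++ l2].
Proof.
elim: s w l => [|[p x] s IH] w l /= h.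
  exists 0, [::], w, l; rewrite add0r; split => //; exact: bindR_nil.
move: h => /bindR_cons_inv[w1 [l1 [w2 [l2 [h1 /IH h2 -> ->]]]]].
case: h2 => [w3 [l3 [w4 [l4 [h3 h4 -> ->]]]]].
exists (p * w1 + w3), (mscale p l1 ++ l3), w4, l4.
by rewrite addrA catA; split => //; exact: bindR_cons.
Qed.

Lemma bindR_scale u w s l :
  bindR P w s l -> bindR P (u * w) (mscale u s) (mscale u l).
Proof.
elim => [|p x s0 w0 l0 w1 l1 hP _ IH] /=.
  by rewrite mulr0; exact: bindR_nil.
by rewrite mulrDr mulrA mscale_cat mscale_mscale; exact: bindR_cons.
Qed.

Lemma bindR_scale_inv u w s l : bindR P w (mscale u s) l ->
  exists w0 l0, [/\ bindR P w0 s l0, w = u * w0 & l = mscale u l0].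
Proof.
elim: s w l => [|[p x] s IH] w l /=.
  by move=> /bindR_nil_inv[-> ->]; exists 0, [::]; rewrite mulr0; split => //; exact: bindR_nil.
move=> /bindR_cons_inv[w1 [l1 [w2 [l2 [h1 /IH[w3 [l3 [h3 -> ->]]] -> ->]]]]].
exists (p * w1 + w3), (mscale p l1 ++ l3).
by rewrite mulrDr mulrA mscale_cat mscale_mscale; split => //; exact: bindR_cons.
Qed.

(** The outcomes are permuted along with the elements that yield them, while the cost, a sum, is
    unchanged. *)
Lemma bindR_mset_eq (E : T -> T -> Prop) w s t l :
  (forall w x y l, E x y -> P w x l -> P w y l) ->
  mset_eq E s t -> bindR P w s l ->
  exists2 l', bindR P w t l' & mset_eq eq l l'.
Proof.
move=> EP h; elim: h w l => {s t} [|q x y s t e _ IH|[q x] [r y] s|s t u _ IH1 _ IH2] w l.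
- by move=> h; exists l => //; exact: mset_eq_refl.
- move=> /bindR_cons_inv[w1 [l1 [w2 [l2 [/(EP _ _ _ _ e) h1 /IH[l3 h3 e3] -> ->]]]]].
  exists (mscale q l1 ++ l3); first exact: bindR_cons.
  by apply: mset_eq_cat => //; exact: mset_eq_refl.
- move=> /bindR_cons_inv[w1 [l1 [w2 [l2 [h1 h2 -> ->]]]]].
  move: h2 => /bindR_cons_inv[w3 [l3 [w4 [l4 [h3 h4 -> ->]]]]].
  exists (mscale r l3 ++ mscale q l1 ++ l4); last exact: mset_eq_catCA.
  by rewrite addrCA; do 2 apply: bindR_cons => //.
- move=> /IH1[l1 /IH2[l2 h2 e2] e1]; exists l2 => //.
  exact: mset_eq_trans e1 e2.
Qed.

Lemma bindR_family (I : Type) (r : seq I) (p : I -> rat) (x : I -> T)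
    (w : I -> rat) (l : I -> seq (rat * U)) :
  (forall i, P (w i) (x i) (l i)) ->
  bindR P (\sum_(i <- r) p i * w i) [seq (p i, x i) | i <- r]
    (flatten [seq mscale (p i) (l i) | i <- r]).
Proof.
move=> h; elim: r => [|i r IH] /=; first by rewrite big_nil; exact: bindR_nil.
by rewrite big_cons; exact: bindR_cons.
Qed.

Lemma bindR_ord (n : nat) (p : 'I_n -> rat) (x : 'I_n -> T)
    (w : 'I_n -> rat) (l : 'I_n -> seq (rat * U)) :
  (forall i, P (w i) (x i) (l i)) ->
  bindR P (\sum_(i < n) p i * w i) [seq (p i, x i) | i : 'I_n]
    (flatten [seq mscale (p i) (l i) | i : 'I_n]).
Proof. by move=> h; rewrite -big_enum /=; exact: bindR_family. Qed.

(** Returns from the inductive form to families over ['I_n], the form of the premises of the typing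
    rules. Prepending an entry to a family is done with [unlift ord0]. *)
Lemma bindR_ord_inv w s l : bindR P w s l ->
  exists n (p : 'I_n -> rat) (x : 'I_n -> T) (w' : 'I_n -> rat)
      (l' : 'I_n -> seq (rat * U)),
    [/\ s = [seq (p i, x i) | i : 'I_n], w = \sum_(i < n) p i * w' i,
        l = flatten [seq mscale (p i) (l' i) | i : 'I_n]
      & forall i, P (w' i) (x i) (l' i)].
Proof.
have cons_ord (V : Type) n (v : V) (f : 'I_n -> V) :
    v :: [seq f i | i : 'I_n] =
    [seq oapp f v (unlift ord0 i) | i : 'I_n.+1].
  rewrite /image_mem enum_ordSl /= unlift_none; congr (_ :: _).
  by rewrite -map_comp; apply: eq_map => i /=; rewrite liftK.
elim => {w s l} [|p x s w l w' l' hP _ [n [q [y [v [m [-> -> -> h]]]]]]].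
  have f (V : Type) : 'I_0 -> V by case.
  exists 0%N, (f _), (f _), (f _), (f _); rewrite big_ord0 /image_mem.
  by rewrite (size0nil (size_enum_ord 0)); split => // -[].
exists n.+1, (fun i => oapp q p (unlift ord0 i)),
  (fun i => oapp y x (unlift ord0 i)), (fun i => oapp v w (unlift ord0 i)),
  (fun i => oapp m l (unlift ord0 i)); split.
- rewrite (cons_ord _ n (p, x)); apply: eq_map => i.
  by case: (unlift ord0 i).
- rewrite big_ord_recl /= unlift_none; congr (_ + _).
  by apply: eq_bigr => i _; rewrite liftK.
- transitivity (flatten (mscale p l :: [seq mscale (q i) (m i) | i : 'I_n])) => //.
  rewrite (cons_ord _ n (mscale p l)); congr flatten; apply: eq_map => i.
  by case: (unlift ord0 i).
- by move=> i; case: (unlift ord0 i).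
Qed.

End BindR.

(** * Evaluation trees *)

(* [ev w M l]: a finite unfolding of the reduction of [M] performs [w] steps
   on average and reaches the values [l]; [ev_stop] cuts a branch anywhere. *)
Inductive ev : rat -> tm -> seq (rat * value) -> Prop :=
  | ev_stop M : ev 0 M [::]
  | ev_val V : ev 0 (Val V) [:: (1, V)]
  | ev_step M ms w l :
      step rat M = Some ms -> bindR ev w ms l -> ev (w + 1) M l.

(** Supplies the induction hypothesis for the branches, which are hidden under [bindR]. *)
Lemma ev_nested_ind (P : rat -> tm -> seq (rat * value) -> Prop) :
  (forall M, P 0 M [::]) -> (forall V, P 0 (Val V) [:: (1, V)]) ->
  (forall M ms w l, step rat M = Some ms ->
     bindR (fun w M l => ev w M l /\ P w M l) w ms l -> P (w + 1) M l) ->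
  forall w M l, ev w M l -> P w M l.
Proof.
move=> h0 hV hS; fix IH 4 => w M l [M0|V|M0 ms w0 l0 st h]; [exact: h0|exact: hV|].
exact: hS st (bindR_mono (fun w M l e => conj e (IH w M l e)) h).
Qed.

(** Branches have different depths; as E_k and P_k grow with k, the maximum of the depths serves all
    of them. A cut leaf contributes 0 to both sides of the account. *)
Lemma ev_bounds w M l :
  ev w M l -> exists k, w <= Ek rat k M /\ mass l <= Pk rat k M.
Proof.
elim/ev_nested_ind => {w M l}.
- by move=> M; exists 0%N; rewrite Ek_ge0 /mass big_nil Pk_ge0.
- move=> V; exists 0%N; rewrite Ek_ge0 Pk_val /mass big_cons big_nil /=.
  by split.
move=> M ms w l st h.
have [k [le_w le_l]] : exists k, w <= \sum_(x <- ms) x.1 * Ek rat k x.2 /\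
    mass l <= \sum_(x <- ms) x.1 * Pk rat k x.2.
  move: (step_gt0 st) => {st M}.
  elim: h => {ms w l} [|p M s w l w' l' [_ [k [le_w le_l]]] _ IH] /=.
    by exists 0%N; rewrite /mass !big_nil.
  move=> /andP[p_gt0 pos]; have [j [le_w' le_l']] := IH pos.
  have mono (f : nat -> tm -> rat) i : (forall a b N, (a <= b)%N -> f a N <= f b N) ->
      (i <= maxn k j)%N -> \sum_(x <- s) x.1 * f i x.2 <=
        \sum_(x <- s) x.1 * f (maxn k j) x.2.
    move=> mf le_i; elim: s pos {IH le_w' le_l'} => [|x s IH] /=; first by rewrite !big_nil.
    move=> /andP[x_gt0 /IH le_s]; rewrite !big_cons lerD //.
    by apply: ler_wpM2l; [exact: ltW | exact: mf].
  exists (maxn k j); rewrite !big_cons mass_cat mass_scale /=.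
  split; apply: lerD.
  + by rewrite ler_pM2l //; apply: le_trans le_w _; rewrite Ek_mono ?leq_maxl.
  + by apply: le_trans le_w' _; apply: (mono (Ek rat)) => [*|]; rewrite ?leq_maxr ?Ek_mono.
  + by rewrite ler_pM2l //; apply: le_trans le_l _; rewrite Pk_mono ?leq_maxl.
  + by apply: le_trans le_l' _; apply: (mono (Pk rat)) => [*|]; rewrite ?leq_maxr ?Pk_mono.
exists k.+1; rewrite (EkS _ st) (PkS_step _ st); split=> //.
by rewrite addrC lerD2l.
Qed.

Lemma ev_let M w0 N l w L : ev w0 N l -> closed_term N -> tclosed_at 1 M ->
  bindR (fun w V L => ev w (subst1 M V) L) w l L ->
  ev (w0 + w + 1) (Let N M) L.
Proof.
move=> e cN cM; move: e w L cN; elim/ev_nested_ind => {w0 N l}.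
- move=> N w L cN /bindR_nil_inv[-> ->]; rewrite addr0.
  have [||ms st] := @step_progress rat (Let N M).
  + by rewrite /closed_term /= cM andbT.
  + by [].
  apply: ev_step st _; elim: ms => [|[p N'] ms IH]; first exact: bindR_nil.
  by rewrite -[0 in X in bindR _ X](mulr0 p) -[_ * _]addr0; exact: bindR_cons (ev_stop _) IH.
- move=> V w L _ hL; have [w1 [l1 [h -> ->]]] := bindR_one_inv hL; rewrite add0r.
  by apply: (@ev_step _ [:: (1, subst1 M V)]) => //; exact: bindR_one.
move=> N ms w0 l st h w L cN hL.
(* The 1 still owed is written as the mass of the step, so that each branch inherits its share of
   it. *)
rewrite (addrAC w0) (_ : w0 + w + 1 = w0 + w + mass ms); last by rewrite (step_mass st).
apply: ev_step (step_letC M st) _.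
move: (step_closed cN st) => {st cN N}.
elim: h w L hL => {ms w0 l} [|p N s w0 l w0' l' [_ IHN] _ IH] w L /=.
  by move=> /bindR_nil_inv[-> ->] _; rewrite /mass big_nil !addr0; exact: bindR_nil.
move=> /bindR_cat_inv[_ [_ [w2 [l2 [/bindR_scale_inv[w1 [l1 [h1 -> ->]]] h2 -> ->]]]]].
move=> /andP[cN cs].
have -> : p * w0 + w0' + (p * w1 + w2) + mass ((p, N) :: s) =
    p * (w0 + w1 + 1) + (w0' + w2 + mass s).
  by rewrite /mass big_cons /=; ring.
exact: bindR_cons (IHN _ _ cN h1) (IH _ _ h2 cs).
Qed.

(** * Realizability *)

(** [P] stays outside the [fix], so that the guard condition accepts the nested recursion of
    [realA]; the same holds for [matches]. *)
Definition allW (T : Type) (P : T -> rat -> Prop) :=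
  fix allW (s : seq (rat * T)) (w : rat) {struct s} : Prop :=
    match s with
    | [::] => w = 0
    | (q, x) :: s' =>
        exists w1 w2, [/\ P x w1, allW s' w2 & w = q * w1 + w2]
    end.

Definition matches (T : Type) (P : T -> rat -> value -> Prop) :=
  fix matches (b : seq (rat * T)) (w : rat) (l : seq (rat * value)) {struct b} :
      Prop :=
    match b, l with
    | [::], [::] => w = 0
    | (p, x) :: b', (r, V) :: l' =>
        r = p /\ vclosed_at 0 V /\
        exists w1 w2, [/\ P x w1 V, matches b' w2 l' & w = p * w1 + w2]
    | _, _ => False
    end.

(** [w0] is spent on the steps of the tree, [w1] remains as potential at its leaves; [l'] reorders
    the leaves so that they align with [b]. *)
Definition produces (T : Type) (P : T -> rat -> value -> Prop)
    (b : seq (rat * T)) (w : rat) (M : tm) : Prop :=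
  exists w0 w1 l l',
    [/\ ev w0 M l, mset_eq eq l l', matches P b w1 l' & w = w0 + w1].

(* [realA A w V]: the closed value [V] can be used at type [A] with
   potential [w], to be spent on the steps of its applications. *)
Fixpoint realA (A : arrow) (w : rat) (V : value) {struct A} : Prop :=
  let: Arr m b := A in
  forall W v, vclosed_at 0 W -> allW (fun A' w' => realA A' w' W) m v ->
    produces (fun m' w' V' => allW (fun A' w'' => realA A' w'' V') m' w')
      b (w + v) (App V W).

Definition realI (m : itype) (w : rat) (V : value) : Prop :=
  allW (fun A w' => realA A w' V) m w.

Definition realD (b : dtype) (w : rat) (M : tm) : Prop := produces realI b w M.

(** * Splitting and combining potentials *)

Section AllW.
Variables (T : Type) (P : T -> rat -> Prop).
Implicit Types s t : seq (rat * T).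

Lemma allW_cat_inv s t w : allW P (s ++ t) w ->
  exists w1 w2, [/\ allW P s w1, allW P t w2 & w = w1 + w2].
Proof.
elim: s w => [|[q x] s IH] w /=; first by exists 0, w; rewrite add0r.
move=> [w1 [_ [h1 /IH[w2 [w3 [h2 h3 ->]]] ->]]].
by exists (q * w1 + w2), w3; split; rewrite ?addrA //; exists w1, w2.
Qed.

Lemma allW_scale_inv u s w : allW P (mscale u s) w ->
  exists w0, allW P s w0 /\ w = u * w0.
Proof.
elim: s w => [|[q x] s IH] w /=; first by move=> ->; exists 0; rewrite mulr0.
move=> [w1 [_ [h1 /IH[w2 [h2 ->]] ->]]].
exists (q * w1 + w2); rewrite mulrDr mulrA; split => //.
by exists w1, w2.
Qed.

Lemma allW_mset_eq E s t w : (forall x y, E x y -> forall v, P x v -> P y v) ->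
  mset_eq E s t -> allW P s w -> allW P t w.
Proof.
move=> EP h; elim: h w => {s t} [|q x y s t e _ IH|[q x] [r y] s|s t u _ IH1 _ IH2] w //=.
- move=> [w1 [w2 [h1 /IH h2 ->]]]; exists w1, w2; split => //; exact: EP h1.
- move=> [w1 [_ [h1 [w2 [w3 [h2 h3 ->]]] ->]]].
  exists w2, (q * w1 + w3); rewrite addrCA; split => //.
  by exists w1, w3.
- by move=> /IH1/IH2.
Qed.

(** Distinct indices let the family of potentials be built by pointwise update at the head of the
    list. *)
Lemma allW_flatten_inv (I : eqType) (r : seq I) (q : I -> rat)
    (f : I -> seq (rat * T)) w : uniq r ->
  allW P (flatten [seq mscale (q i) (f i) | i <- r]) w ->
  exists v : I -> rat, (forall i, i \in r -> allW P (f i) (v i)) /\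
    w = \sum_(i <- r) q i * v i.
Proof.
elim: r w => [|i r IH] w /=; first by move=> _ ->; exists (fun=> 0); rewrite big_nil.
move=> /andP[ir ur] /allW_cat_inv[_ [w2 [/allW_scale_inv[w1 [h1 ->]] h2 ->]]].
have [v [hv ->]] := IH _ ur h2.
exists (fun j => if j == i then w1 else v j); split=> [j|].
  by rewrite inE; case: eqP => [-> //|_ /hv].
rewrite big_cons eqxx; congr (_ + _); rewrite !big_seq.
by apply: eq_bigr => j jr; case: eqP => // ji; rewrite -ji jr in ir.
Qed.

Lemma allW_map (I : Type) (r : seq I) (q : I -> rat) (x : I -> T) v :
  (forall i, P (x i) (v i)) ->
  allW P [seq (q i, x i) | i <- r] (\sum_(i <- r) q i * v i).
Proof.
move=> h; elim: r => [|i r IH] /=; first by rewrite big_nil.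
by exists (v i), (\sum_(i <- r) q i * v i); rewrite big_cons.
Qed.

End AllW.

Section Matches.
Variables (T : Type) (P : T -> rat -> value -> Prop).
Implicit Types (b : seq (rat * T)) (l : seq (rat * value)).

Lemma matches_cat b b' w w' l l' : matches P b w l -> matches P b' w' l' ->
  matches P (b ++ b') (w + w') (l ++ l').
Proof.
move=> h h'; elim: b w l h => [|[p x] b IH] w [|[r V] l] //=.
  by move=> ->; rewrite add0r.
move=> [-> [cV [w1 [w2 [h1 /IH h2 ->]]]]]; split=> //; split=> //.
by exists w1, (w2 + w'); rewrite addrA.
Qed.

Lemma matches_scale u b w l : matches P b w l ->
  matches P (mscale u b) (u * w) (mscale u l).
Proof.
elim: b w l => [|[p x] b IH] w [|[r V] l] //=; first by move=> ->; rewrite mulr0.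
move=> [-> [cV [w1 [w2 [h1 /IH h2 ->]]]]]; split=> //; split=> //.
by exists w1, (u * w2); rewrite mulrDr mulrA.
Qed.

Lemma matches_mset_eq E b b' w l :
  (forall x y, E x y -> forall v V, P x v V -> P y v V) ->
  mset_eq E b b' -> matches P b w l ->
  exists2 l', mset_eq eq l l' & matches P b' w l'.
Proof.
move=> EP h; elim: h w l => {b b'} [|q x y s t e _ IH|[q x] [r y] s|s t u _ IH1 _ IH2] w l.
- by move=> h; exists l => //; exact: mset_eq_refl.
- case: l => [|[r V] l] //= [-> [cV [w1 [w2 [h1 /IH[l' e' h2] ->]]]]].
  exists ((q, V) :: l') => /=; first exact: mset_eq_skip.
  by do 2 split=> //; exists w1, w2; split=> //; exact: EP h1.
- case: l => [|[q' V] [|[r' W] l]] //=; first by move=> [_ [_ [? [? []]]]].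
  move=> [-> [cV [w1 [_ [h1 [-> [cW [w2 [w3 [h2 h3 ->]]]]] ->]]]]].
  exists ((r, W) :: (q, V) :: l) => /=; first exact: mset_eq_swap.
  do 2 split=> //; exists w2, (q * w1 + w3); rewrite addrCA; split=> //.
  by do 2 split=> //; exists w1, w3.
- move=> /IH1[l1 e1 /IH2[l2 e2 h2]]; exists l2 => //.
  exact: mset_eq_trans e1 e2.
Qed.

Lemma matches_mass b w l : matches P b w l -> mass l = mass b.
Proof.
elim: b w l => [|[p x] b IH] w [|[r V] l] //; first by rewrite /mass !big_nil.
by move=> /= [-> [_ [w1 [w2 [_ /IH h _]]]]]; rewrite /mass !big_cons -/(mass _) h.
Qed.

Lemma produces_mset_eq E b b' w M :
  (forall x y, E x y -> forall v V, P x v V -> P y v V) ->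
  mset_eq E b b' -> produces P b w M -> produces P b' w M.
Proof.
move=> EP e [w0 [w1 [l [l' [h el /(matches_mset_eq EP e)[l2 e2 h2] ->]]]]].
by exists w0, w1, l, l2; split=> //; exact: mset_eq_trans el e2.
Qed.

Lemma produces_nil M : produces P [::] 0 M.
Proof.
exists 0, 0, [::], [::]; rewrite addr0; split=> //; first exact: ev_stop.
exact: mset_eq_nil.
Qed.

Lemma produces_step1 b w M N :
  step rat M = Some [:: (1, N)] -> produces P b w N -> produces P b (w + 1) M.
Proof.
move=> st [w0 [w1 [l [l' [h el hl ->]]]]].
exists (w0 + 1), w1, l, l'; rewrite addrAC; split => //.
apply: ev_step st _; rewrite -[w0]mul1r -[l]mscale1; exact: bindR_one.
Qed.

Lemma produces_oplus a b w v M N : produces P a w M -> produces P b v N ->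
  produces P (mscale 2^-1 a ++ mscale 2^-1 b) (2^-1 * w + 2^-1 * v + 1)
    (Oplus M N).
Proof.
move=> [w0 [w1 [l [l' [h e hl ->]]]]] [v0 [v1 [r [r' [k f hr ->]]]]].
exists (2^-1 * w0 + 2^-1 * v0 + 1), (2^-1 * w1 + 2^-1 * v1),
  (mscale 2^-1 l ++ mscale 2^-1 r), (mscale 2^-1 l' ++ mscale 2^-1 r'); split.
- by apply: (@ev_step _ [:: (2^-1, M); (2^-1, N)]) => //; apply: bindR_cons h (bindR_one _ k).
- by apply: mset_eq_cat => //; exact: mset_eq_scale.
- by apply: matches_cat; exact: matches_scale.
- by ring.
Qed.

End Matches.

(** * Invariance under equality of types *)

Definition arrow_eq_nested_ind (P : arrow -> arrow -> Prop)
    (step : forall m m' a a', mset_eq P m m' -> mset_eq (mset_eq P) a a' ->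
       P (Arr m a) (Arr m' a')) :=
  fix ind A A' (h : arrow_eq A A') {struct h} : P A A' :=
    match h with
    | ArrEq m m' a a' em ea =>
        step m m' a a' (mset_eq_mono ind em)
          (mset_eq_mono (mset_eq_mono ind) ea)
    end.

(** An equivalence, because the source of an arrow is contravariant: the induction hypothesis is
    used backwards on the argument and forwards on the result. *)
Lemma realA_eq A A' : arrow_eq A A' -> forall w V, realA A w V <-> realA A' w V.
Proof.
pose E A A' := forall w V, realA A w V <-> realA A' w V.
have symE A1 A2 : E A1 A2 -> E A2 A1 by move=> h w V; split=> /h.
have EI m m' : mset_eq E m m' -> forall w V, realI m w V -> realI m' w V.
  by move=> e w V; apply: allW_mset_eq e => x y exy v; case: (exy v V).
have half m m' a a' : mset_eq E m m' -> mset_eq (mset_eq E) a a' ->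
    forall w V, realA (Arr m a) w V -> realA (Arr m' a') w V.
  move=> em ea w V h W v cW hW; apply: (produces_mset_eq (E := mset_eq E)) ea _.
    exact: EI.
  by apply: h cW _; apply: EI hW; exact: mset_eq_sym em.
elim/arrow_eq_nested_ind => m m' a a' em ea w V; split; first exact: half.
apply: half; first exact: mset_eq_sym em.
by apply: mset_eq_sym ea => x y; exact: mset_eq_sym.
Qed.

Lemma arrow_eq_sym A A' : arrow_eq A A' -> arrow_eq A' A.
Proof.
elim/arrow_eq_nested_ind => m m' a a' em ea; constructor.
  exact: mset_eq_sym em.
by apply: mset_eq_sym ea => x y; exact: mset_eq_sym.
Qed.

Lemma realI_eq m m' : itype_eq m m' -> forall w V, realI m w V -> realI m' w V.
Proof.
move=> e w V; apply: allW_mset_eq e => x y exy v.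
by case: (realA_eq exy v V).
Qed.

(** The potential left at the leaves of the tree of [N] is handed to the bodies, whose trees are
    then grafted by [ev_let]. *)
Lemma realD_let n (p : 'I_n -> rat) (m : 'I_n -> itype) (w : 'I_n -> rat)
    (b : 'I_n -> dtype) v N M :
  closed_term N -> tclosed_at 1 M ->
  realD [seq (p k, m k) | k : 'I_n] v N ->
  (forall k V u, vclosed_at 0 V -> realI (m k) u V ->
     realD (b k) (w k + u) (subst1 M V)) ->
  realD (flatten [seq mscale (p k) (b k) | k : 'I_n])
    (\sum_(k < n) p k * w k + v + 1) (Let N M).
Proof.
move=> cN cM [w0 [w1 [l [l' [h e hl ->]]]]] hM.
rewrite /image_mem -big_enum /= in hl *.
have [wB [L [L' [w2 [hB eL hL ew]]]]] : exists wB L L' w2,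
    [/\ bindR (fun w V L => ev w (subst1 M V) L) wB l' L, mset_eq eq L L',
        matches realI (flatten [seq mscale (p k) (b k) | k <- enum 'I_n]) w2 L'
      & \sum_(k <- enum 'I_n) p k * w k + w1 = wB + w2].
  elim: (enum 'I_n) l' w1 hl {e} => [|k r IH] [|[q V] l'] u //=.
    move=> ->; exists 0, [::], [::], 0; rewrite big_nil; split=> //.
      exact: bindR_nil.
    exact: mset_eq_nil.
  move=> [-> [cV [u1 [u2 [hV /IH[wB [L [L' [w2 [hB eL hL ew]]]]] ->]]]]].
  have [x0 [x1 [j [j' [hj ej hj' ex]]]]] := hM _ _ _ cV hV.
  exists (p k * x0 + wB), (mscale (p k) j ++ L), (mscale (p k) j' ++ L'),
    (p k * x1 + w2); split.
  - exact: bindR_cons.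
  - by apply: mset_eq_cat => //; exact: mset_eq_scale.
  - by apply: matches_cat => //; exact: matches_scale.
  - rewrite big_cons; transitivity (p k * (w k + u1) + (wB + w2)).
      by rewrite -ew; ring.
    by rewrite ex; ring.
(* The body trees were built along [l'], the order of the types; grafting needs them along [l], the
   order of the tree of [N]. *)
have [|L2 hB2 e2] := bindR_mset_eq _ (mset_eq_sym (fun x y => @esym _ x y) e) hB.
  by move=> ? ? ? ? ->.
exists (w0 + wB + 1), w2, L2, L'; split=> //.
- exact: ev_let h cN cM hB2.
- by apply: mset_eq_trans eL; apply: mset_eq_sym e2.
- transitivity (w0 + (\sum_(k <- enum 'I_n) p k * w k + w1) + 1); first by ring.
  by rewrite ew; ring.
Qed.

(** * Soundness *)

Scheme tyA_mind := Minimality for tyA Sort Prop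
  with tyI_mind := Minimality for tyI Sort Prop
  with tyD_mind := Minimality for tyD Sort Prop.
Combined Scheme ty_ind from tyA_mind, tyI_mind, tyD_mind.

Fixpoint realC (E : seq value) (G : ctx) (u : rat) : Prop :=
  if E is V :: E' then
    exists u1 u2, [/\ realI (G 0%N) u1 V, realC E' (fun x => G x.+1) u2
                    & u = u1 + u2]
  else u = 0.

Definition env (E : seq value) (x : nat) : value := nth (Var 0) E x.

Lemma subst1_env E M V : all (vclosed_at 0) E -> vclosed_at 0 V ->
  tclosed_at (size E).+1 M ->
  subst1 (tsubst (up_subst (env E)) M) V = tsubst (env (V :: E)) M.
Proof.
move=> cE cV cM; apply: (subst_comp.2 _ _ _ _ _ cM) => -[_|x lt_x] /=.
  by split=> //; left; exists 0%N.
have cx : vclosed_at 0 (env E x) by apply: all_nthP.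
by rewrite vren_closed // vsubst_closed //; split=> //; right.
Qed.

Lemma realC_eq E G D u : ctx_eq G D -> realC E G u -> realC E D u.
Proof.
elim: E G D u => //= V E IH G D u e [u1 [u2 [/(realI_eq (e 0%N)) h1 h2 ->]]].
by exists u1, u2; split=> //; apply: IH h2 => x; exact: e.
Qed.

Lemma realC0 E u : realC E ctx0 u -> u = 0.
Proof.
by elim: E u => //= V E IH u [_ [u2 [-> /IH -> ->]]]; rewrite addr0.
Qed.

Lemma realC1 E x m u : (x < size E)%N -> realC E (ctx1 x m) u ->
  realI m u (env E x).
Proof.
elim: E x u => // V E IH [|x] u /= lt_x [u1 [u2 [h1 h2 ->]]].
  by rewrite (realC0 (u := u2) h2) addr0.
move: h1; rewrite /realI /= => ->; rewrite add0r; exact: IH.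
Qed.

Lemma realC_add E G D u : realC E (ctx_add G D) u ->
  exists u1 u2, [/\ realC E G u1, realC E D u2 & u = u1 + u2].
Proof.
elim: E G D u => [|V E IH] G D u /=; first by exists 0, 0; rewrite addr0.
move=> [_ [_ [/allW_cat_inv[u1 [u2 [h1 h2 ->]]] /IH[u3 [u4 [h3 h4 ->]]] ->]]].
exists (u1 + u3), (u2 + u4); rewrite addrACA; split=> //; first by exists u1, u3.
by exists u2, u4.
Qed.

Lemma realC_scale E q G u : realC E (ctx_scale q G) u ->
  exists u0, realC E G u0 /\ u = q * u0.
Proof.
elim: E G u => [|V E IH] G u /=; first by exists 0; rewrite mulr0.
move=> [_ [_ [/allW_scale_inv[u1 [h1 ->]] /IH[u2 [h2 ->]] ->]]].
by exists (u1 + u2); rewrite mulrDr; split=> //; exists u1, u2.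
Qed.

Lemma realC_sum E n (q : 'I_n -> rat) (G : 'I_n -> ctx) u :
  realC E (ctx_sum (fun i => ctx_scale (q i) (G i))) u ->
  exists v : 'I_n -> rat, (forall i, realC E (G i) (v i)) /\
    u = \sum_(i < n) q i * v i.
Proof.
elim: E G u => [|V E IH] G u /=.
  by move=> ->; exists (fun=> 0); split=> //; rewrite big1 // => i _; rewrite mulr0.
move=> [u1 [u2 [h1 h2 ->]]]; have [v2 [{}h2 ->]] := IH (fun i x => G i x.+1) _ h2.
move: h1 => /(allW_flatten_inv (enum_uniq _))[v1 [h1 ->]].
exists (fun i => v1 i + v2 i); split=> [i|].
  by exists (v1 i), (v2 i); split=> //; apply: h1; rewrite mem_enum.
by rewrite big_enum -big_split; apply: eq_bigr => i _; rewrite mulrDr.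
Qed.

(** The fundamental lemma of the logical relation: the weight of a derivation and the potentials of
    the values substituted for its variables add up to the potential of the instance. *)
Lemma ty_real :
  (forall G w V A, tyA G w V A -> forall E u, all (vclosed_at 0) E ->
     vclosed_at (size E) V -> realC E G u -> realA A (w + u) (vsubst (env E) V)) /\
  (forall G w V m, tyI G w V m -> forall E u, all (vclosed_at 0) E ->
     vclosed_at (size E) V -> realC E G u -> realI m (w + u) (vsubst (env E) V)) /\
  (forall G w M b, tyD G w M b -> forall E u, all (vclosed_at 0) E ->
     tclosed_at (size E) M -> realC E G u -> realD b (w + u) (tsubst (env E) M)).
Proof.
apply: ty_ind.
- move=> G w M m b _ IH E u cE cM hu W v cW hW.
  (* The 1 charged by the abstraction rule pays for the beta step when the abstraction is
     applied. *)
  have -> : w + 1 + u + v = w + (v + u) + 1 by ring.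
  apply: produces_step1 => /=; first by [].
  rewrite subst1_env //; apply: IH => //=; first by rewrite cW.
  by exists v, u.
- move=> G G' w V A A' eG eA _ IH E u cE cV /(realC_eq _) hu.
  apply: (realA_eq eA _ _).1; apply: IH => //; apply: hu.
  by move=> x; apply: mset_eq_sym (eG x) => a b; exact: arrow_eq_sym.
- move=> x m _ E u cE /= lt_x hu; rewrite add0r; exact: realC1.
- move=> n q G w V A _ _ IH E u cE cV /realC_sum[v [hv ->]].
  rewrite -big_split (eq_bigr (fun i => q i * (w i + v i))); last first.
    by move=> i _; rewrite mulrDr.
  by rewrite -big_enum /=; apply: allW_map => i; exact: IH.
- move=> G G' w V m m' eG em _ IH E u cE cV hu.
  apply: (realI_eq em); apply: IH => //; apply: realC_eq hu.
  by move=> x; apply: mset_eq_sym (eG x) => a b; exact: arrow_eq_sym.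
- by move=> M E u _ _ /realC0 ->; rewrite addr0; exact: produces_nil.
- move=> G D w v V W m b _ IHV _ IHW E u cE /= /andP[cV cW].
  move=> /realC_add[u1 [u2 [h1 h2 ->]]].
  (* Rule (@) asks for scale factor 1, so the whole potential of the function is available to this
     application. *)
  have [w1 [_ [hA -> ew]]] := IHV _ _ cE cV h1.
  have cW' : vclosed_at 0 (vsubst (env E) W).
    by apply: (closed_subst.1 _ _ _ _ cW) => x lt_x; apply: all_nthP.
  have := hA _ _ cW' (IHW _ _ cE cW h2).
  by rewrite addrACA ew mul1r addr0.
- move=> G D w v M N a b _ IHM _ IHN E u cE /= /andP[cM cN].
  move=> /realC_add[_ [_ [/realC_scale[u1 [h1 ->]] /realC_scale[u2 [h2 ->]] ->]]].
  have := produces_oplus (IHM _ _ cE cM h1) (IHN _ _ cE cN h2).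
  by congr (produces _ _ _ _); ring.
- move=> n p m D w b G v N M _ IHN _ IHM E u cE /= /andP[cN cM].
  move=> /realC_add[u1 [_ [h1 /realC_sum[x [hx ->]] ->]]].
  have cl_env y : (y < size E)%N -> vclosed_at 0 (env E y).
    by move=> lt_y; apply: all_nthP.
  have -> : \sum_(k < n) p k * w k + v + 1 + (u1 + \sum_(i < n) p i * x i) =
      \sum_(k < n) p k * (w k + x k) + (v + u1) + 1.
    by under [in RHS]eq_bigr do rewrite mulrDr; rewrite big_split /=; ring.
  apply: (realD_let (w := fun k => w k + x k)) (IHN _ _ cE cN h1) _.
  + exact: (closed_subst.2 _ _ _ _ cN).
  + apply: (closed_subst.2 _ _ _ _ cM) => -[_|y /cl_env cy] //=.
    by rewrite vren_closed //; exact: (closed_le.1 _ 0%N).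
  move=> k V y cV hV; rewrite subst1_env // -addrA.
  apply: IHM => //=; first by rewrite cV.
  by exists y, (x k); rewrite addrC.
- move=> G w V m _ IH E u cE cV hu.
  (* A value makes no step: nothing is spent and all the potential stays at the single leaf. *)
  exists 0, (w + u), [:: (1, vsubst (env E) V)], [:: (1, vsubst (env E) V)].
  rewrite add0r; split=> //; [exact: ev_val | exact: mset_eq_refl |].
  split=> //; split.
    by apply: (closed_subst.1 _ _ _ _ cV) => x lt_x; apply: all_nthP.
  by exists (w + u), 0; rewrite mul1r addr0; split=> //; exact: IH.
- move=> G G' w M a a' eG ea _ IH E u cE cM hu.
  apply: (produces_mset_eq (E := itype_eq)) ea _.
    by move=> x y e v V; exact: realI_eq.
  apply: IH => //; apply: realC_eq hu.
  by move=> x; apply: mset_eq_sym (eG x) => c d; exact: arrow_eq_sym.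
Qed.

Theorem soundness w M a : closed_term M -> tight_typing w M a ->
  exists k, w <= Ek rat k M /\ mass a <= Pk rat k M.
Proof.
move=> cM [/ty_real.2.2 h tight_a].
have [w0 [w1 [l [l' [e el hl]]]]] := h [::] 0 isT cM erefl.
rewrite addr0 tsubst_closed // in e *.
have -> : w1 = 0.
  elim: a tight_a l' w1 hl {h el} => [|[p [|//]] a IH] /= ta [|[r V] l'] u //.
  by move=> [_ [_ [_ [u2 [-> /(IH ta) -> ->]]]]]; rewrite mulr0 addr0.
rewrite addr0 => ->; rewrite -(matches_mass hl) -(mset_eq_mass el).
exact: ev_bounds.
Qed.

(** * Well-formedness and relevance *)

Lemma coef_okM p q : coef_ok p -> coef_ok q -> coef_ok (p * q).
Proof.
move=> /andP[p0 p1] /andP[q0 q1]; rewrite /coef_ok mulr_gt0 //=.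
by rewrite mulr_ile1 // ltW.
Qed.

Lemma coefs_wf_scale (T : Type) (P : T -> bool) u s :
  coef_ok u -> coefs_wf P s -> coefs_wf P (mscale u s).
Proof.
move=> cu; rewrite /coefs_wf all_map; apply: sub_all => x /= /andP[cx ->].
by rewrite coef_okM.
Qed.

Lemma coefs_wf_cat (T : Type) (P : T -> bool) (s t : seq (rat * T)) :
  coefs_wf P (s ++ t) = coefs_wf P s && coefs_wf P t.
Proof. exact: all_cat. Qed.

Lemma coefs_wf_flatten (T : Type) (P : T -> bool) (I : Type) (r : seq I)
    (f : I -> seq (rat * T)) :
  (forall i, coefs_wf P (f i)) -> coefs_wf P (flatten (map f r)).
Proof. by move=> h; elim: r => //= i r IH; rewrite coefs_wf_cat h. Qed.

Lemma coefs_wf_ord (T : Type) (P : T -> bool) n (p : 'I_n -> rat)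
    (x : 'I_n -> T) :
  coefs_wf P [seq (p i, x i) | i : 'I_n] <->
  (forall i, coef_ok (p i)) /\ (forall i, P (x i)).
Proof.
rewrite /coefs_wf all_map; split=> [/allP h|[hp hx]].
  by split=> i; have /andP[] := h i (mem_enum _ _).
by apply/allP => i _ /=; rewrite hp hx.
Qed.

Lemma arrow_eq_wf A A' : arrow_eq A A' -> arrow_wf A = arrow_wf A'.
Proof.
elim/arrow_eq_nested_ind => m m' a a' em ea /=.
rewrite (mset_eq_coefs em) // (mset_eq_mass ea) (mset_eq_coefs ea) //.
by move=> x y e; apply: mset_eq_coefs e _.
Qed.

Lemma itype_eq_wf m m' : itype_eq m m' -> itype_wf m = itype_wf m'.
Proof. by move=> e; apply: mset_eq_coefs e _; exact: arrow_eq_wf. Qed.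

Definition dtype_wf (a : dtype) : bool := coefs_wf itype_wf a && (mass a <= 1).

Lemma dtype_eq_wf a a' : dtype_eq a a' -> dtype_wf a = dtype_wf a'.
Proof.
move=> e; rewrite /dtype_wf (mset_eq_mass e) (mset_eq_coefs e) //.
exact: itype_eq_wf.
Qed.

Lemma mass_flatten_le1 n (p : 'I_n -> rat) (b : 'I_n -> dtype) :
  (forall k, coef_ok (p k)) -> \sum_(k < n) p k <= 1 ->
  (forall k, mass (b k) <= 1) ->
  mass (flatten [seq mscale (p k) (b k) | k : 'I_n]) <= 1.
Proof.
move=> hp le_p hb; apply: le_trans le_p; rewrite -big_enum /= /image_mem.
elim: (enum 'I_n) => [|k r IH] /=; first by rewrite /mass !big_nil.
rewrite big_cons mass_cat mass_scale lerD // ler_piMr //.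
by case/andP: (hp k) => /ltW.
Qed.

(** Provides the side conditions of [ty_var] and [ty_bang] when typings are reassembled during
    anti-substitution and expansion. *)
Lemma ty_wf :
  (forall G w V A, tyA G w V A -> arrow_wf A /\ forall x, itype_wf (G x)) /\
  (forall G w V m, tyI G w V m -> itype_wf m /\ forall x, itype_wf (G x)) /\
  (forall G w M b, tyD G w M b -> dtype_wf b /\ forall x, itype_wf (G x)).
Proof.
have sum_wf n (q : 'I_n -> rat) (G : 'I_n -> ctx) : (forall i, coef_ok (q i)) ->
    (forall i x, itype_wf (G i x)) ->
    forall x, itype_wf (ctx_sum (fun i => ctx_scale (q i) (G i)) x).
  by move=> hq hG x; apply: coefs_wf_flatten => i; exact: coefs_wf_scale.
apply: ty_ind.
- move=> G w M m b _ [/andP[wb mb] wG]; split; last by move=> x; exact: (wG x.+1).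
  by rewrite /= mb andbT; apply/andP; split; [exact: (wG 0%N) | exact: wb].
- move=> G G' w V A A' eG eA _ [wA wG]; split; first by rewrite -(arrow_eq_wf eA).
  by move=> x; rewrite -(itype_eq_wf (eG x)).
- by move=> x m wm; split=> // y; rewrite /ctx1; case: eqP.
- move=> n q G w V A hq _ IH; split; last by apply: sum_wf => // i; case: (IH i).
  by apply/coefs_wf_ord; split=> // i; case: (IH i).
- move=> G G' w V m m' eG em _ [wm wG]; split; first by rewrite -(itype_eq_wf em).
  by move=> x; rewrite -(itype_eq_wf (eG x)).
- by move=> M; split=> //; rewrite /dtype_wf /mass big_nil.
- move=> G D w v V W m b _ [/andP[/andP[_ /and3P[_ wb mb]] _] wG] _ [_ wD].
  split; first by rewrite /dtype_wf mb andbT; exact: wb.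
  by move=> x; rewrite /ctx_add /itype_wf coefs_wf_cat; apply/andP; split; [exact: wG | exact: wD].
- move=> G D w v M N a b _ [/andP[wa ma] wG] _ [/andP[wb mb] wD].
  have h : coef_ok 2^-1 by [].
  split; last first.
    move=> x; rewrite /ctx_add /itype_wf coefs_wf_cat.
    by apply/andP; split; apply: coefs_wf_scale.
  rewrite /dtype_wf coefs_wf_cat !coefs_wf_scale //= mass_cat !mass_scale.
  by lra.
- move=> n p m D w b G v N M _ [/andP[/coefs_wf_ord[hp _] mp] wG] _ IH.
  rewrite /mass big_map big_enum /= in mp.
  split.
    apply/andP; split.
      by apply: coefs_wf_flatten => k; apply: coefs_wf_scale => //; case: (IH k) => /andP[].
    by apply: mass_flatten_le1 => // k; case: (IH k) => /andP[].
  move=> x; rewrite /ctx_add /itype_wf coefs_wf_cat; apply/andP; split; first exact: wG.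
  by apply: sum_wf => // k y; case: (IH k) => _ /(_ y.+1).
- move=> G w V m _ [wm wG]; split=> //.
  by rewrite /dtype_wf /= wm /mass big_cons big_nil.
- move=> G G' w M a a' eG ea _ [wa wG]; split; first by rewrite -(dtype_eq_wf ea).
  by move=> x; rewrite -(itype_eq_wf (eG x)).
Qed.

Lemma flatten_nils (T : Type) (I : Type) (r : seq I) (f : I -> seq T) :
  (forall i, f i = [::]) -> flatten (map f r) = [::].
Proof. by move=> h; elim: r => //= i r ->; rewrite h. Qed.

(** No rule weakens the context, so a typing of a closed term has an empty one, which can be
    exchanged for [ctx0]. *)
Lemma ty_relevant :
  (forall G w V A, tyA G w V A -> forall n x, vclosed_at n V -> (n <= x)%N ->
     G x = [::]) /\
  (forall G w V m, tyI G w V m -> forall n x, vclosed_at n V -> (n <= x)%N ->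
     G x = [::]) /\
  (forall G w M b, tyD G w M b -> forall n x, tclosed_at n M -> (n <= x)%N ->
     G x = [::]).
Proof.
have nil_eq (m m' : itype) : itype_eq m m' -> m = [::] -> m' = [::].
  by move=> e em; apply/nilP; rewrite -(mset_eq_nilp e) em.
apply: ty_ind.
- by move=> G w M m b _ IH n x cM le_nx; exact: (IH n.+1 x.+1).
- move=> G G' w V A A' eG _ _ IH n x cV le_nx.
  exact: nil_eq (eG x) (IH _ _ cV le_nx).
- move=> y m _ n x /= lt_yn le_nx; rewrite /ctx1 gtn_eqF //.
  exact: leq_trans le_nx.
- move=> k q G w V A _ _ IH n x cV le_nx; apply: flatten_nils => i.
  by rewrite /ctx_scale (IH _ _ _ cV).
- move=> G G' w V m m' eG _ _ IH n x cV le_nx.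
  exact: nil_eq (eG x) (IH _ _ cV le_nx).
- by [].
- move=> G D w v V W m b _ IHV _ IHW n x /= /andP[cV cW] le_nx.
  by rewrite /ctx_add (IHV _ _ cV) // (IHW _ _ cW).
- move=> G D w v M N a b _ IHM _ IHN n x /= /andP[cM cN] le_nx.
  by rewrite /ctx_add /ctx_scale (IHM _ _ cM) // (IHN _ _ cN).
- move=> k p m D w b G v N M _ IHN _ IHM n x /= /andP[cN cM] le_nx.
  rewrite /ctx_add (IHN _ _ cN) //; apply: flatten_nils => i.
  by rewrite /ctx_scale (_ : D i x = [::]) //; exact: (IHM i n.+1 x.+1).
- by [].
- move=> G G' w V m m' eG _ _ IH n x cV le_nx.
  exact: nil_eq (eG x) (IH _ _ cV le_nx).
Qed.

Lemma arrow_eq_refl A : arrow_eq A A.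
Proof.
move: A; fix IH 1 => -[m a]; constructor.
  by elim: m => [|[q A] m IHm]; constructor.
elim: a => [|[p m'] a IHa]; constructor => //.
by elim: m' => [|[q A] m' IHm]; constructor.
Qed.

Lemma itype_eq_refl m : itype_eq m m.
Proof. apply: mset_eq_refl; exact: arrow_eq_refl. Qed.

Lemma dtype_eq_refl a : dtype_eq a a.
Proof. apply: mset_eq_refl; exact: itype_eq_refl. Qed.

#[local] Hint Resolve arrow_eq_refl itype_eq_refl dtype_eq_refl : core.

Lemma tyA_ctx G D w V A : ctx_eq G D -> tyA G w V A -> tyA D w V A.
Proof. by move=> e; exact: tyA_eq. Qed.

Lemma tyI_ctx G D w V m : ctx_eq G D -> tyI G w V m -> tyI D w V m.
Proof. by move=> e; exact: tyI_eq. Qed.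

Lemma tyD_ctx G D w M a : ctx_eq G D -> tyD G w M a -> tyD D w M a.
Proof. by move=> e; exact: tyD_eq. Qed.

(** * Intersection types of closed values *)

(* The typings of a closed value at the elements of [m]; there is nothing to
   record besides the cost, hence the empty outcome. *)
Definition typings (V : value) (m : itype) (w : rat) : Prop :=
  bindR (fun w A (l : seq (rat * unit)) => tyA ctx0 w V A /\ l = [::]) w m [::].

Lemma ctx_nil_sum n (q : 'I_n -> rat) x :
  ctx_sum (fun i => ctx_scale (q i) ctx0) x = [::].
Proof. exact: flatten_nils. Qed.

(** Inversion of (!) modulo permutations: (Var) cannot type a closed value and all contexts are
    empty, so only a weighted list of arrow typings remains. Unions and scalings of such typings are
    then read off from [bindR]. *)
Lemma tyI_typings w V m : vclosed_at 0 V ->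
  tyI ctx0 w V m <-> coefs_wf arrow_wf m /\ typings V m w.
Proof.
move=> cV; split=> [h|[wm /bindR_ord_inv[n [p [x [w' [l' [em -> _ h]]]]]]]].
  split; first exact: (ty_wf.2.1 _ _ _ _ h).1.
  move: {1}ctx0 h => G h; elim: h cV => {G w V m} [x m _ //|n q G w V A _ hA cV|
      G G' w V m m' _ em _ IH cV].
    (* The empty outcome is presented as a union of [n] empty outcomes, the shape that [bindR_ord]
       yields. *)
    rewrite /typings -[X in bindR _ _ _ X](@flatten_nils _ _ (enum 'I_n) (fun i => mscale (q i) [::])) //.
    apply: bindR_ord => i; split=> //; apply: tyA_ctx (hA i) => x.
    by rewrite (ty_relevant.1 _ _ _ _ (hA i) 0%N).
  have [|l' h el] := bindR_mset_eq _ em (IH cV).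
    by move=> v x y l exy [h ->]; split=> //; exact: tyA_eq exy h.
  suff: l' = [::] by move=> el'; rewrite el' in h.
  by apply/nilP; rewrite -(mset_eq_nilp el).
move: wm; rewrite em => /coefs_wf_ord[hp _].
apply: tyI_ctx (ty_bang hp (fun i => (h i).1)) => y.
by rewrite ctx_nil_sum.
Qed.

Lemma tyI_nil V : vclosed_at 0 V -> tyI ctx0 0 V [::].
Proof. by move=> cV; apply/tyI_typings => //; split=> //; exact: bindR_nil. Qed.

Lemma tyI_cat V w m w' m' : vclosed_at 0 V ->
  tyI ctx0 w V m -> tyI ctx0 w' V m' -> tyI ctx0 (w + w') V (m ++ m').
Proof.
move=> cV /(tyI_typings _ _ cV)[wm h] /(tyI_typings _ _ cV)[wm' h'].
apply/tyI_typings => //; rewrite coefs_wf_cat wm wm'; split=> //.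
exact: (bindR_cat h h').
Qed.

Lemma tyI_scale V w m u : vclosed_at 0 V -> coef_ok u ->
  tyI ctx0 w V m -> tyI ctx0 (u * w) V (mscale u m).
Proof.
move=> cV cu /(tyI_typings _ _ cV)[wm h].
apply/tyI_typings => //; rewrite coefs_wf_scale //; split=> //.
exact: (bindR_scale u h).
Qed.

Lemma tyI_sum V n (p : 'I_n -> rat) (w : 'I_n -> rat) (m : 'I_n -> itype) :
  vclosed_at 0 V -> (forall k, coef_ok (p k)) ->
  (forall k, tyI ctx0 (w k) V (m k)) ->
  tyI ctx0 (\sum_(k < n) p k * w k) V
    (flatten [seq mscale (p k) (m k) | k : 'I_n]).
Proof.
move=> cV hp h; rewrite -big_enum /= /image_mem.
elim: (enum 'I_n) => [|k r IH] /=; first by rewrite big_nil; exact: tyI_nil.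
by rewrite big_cons; apply: tyI_cat => //; exact: tyI_scale.
Qed.

(** * Anti-substitution *)

(** Lowers no index: it is used on terms closed at [n.+1], where [n] is the largest index, so
    positions in contexts stay put. For [n = 0] it agrees on such terms with [subst1]. *)
Definition subst_at (n : nat) (V : value) (x : nat) : value :=
  if x == n then V else Var x.

Lemma up_subst_at n V x : vclosed_at 0 V ->
  up_subst (subst_at n V) x = subst_at n.+1 V x.
Proof.
move=> cV; case: x => //= x; rewrite /subst_at eqSS.
by case: eqP => // _; rewrite vren_closed.
Qed.

Lemma tsubst_up_at n k V M : vclosed_at 0 V -> tclosed_at k M ->
  tsubst (up_subst (subst_at n V)) M = tsubst (subst_at n.+1 V) M.
Proof. by move=> cV cM; apply: (subst_ext.2 _ _ _ _ cM) => x _; exact: up_subst_at. Qed.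

Section AntiSubstitution.
Variables (V : value) (cV : vclosed_at 0 V).

(* A typing of [M{V/n}] with context [G] and weight [w] splits into a typing
   [Q] of [M] and a typing of [V] at the type that [M] requires of [n]. *)
Definition splits (n : nat) (G : ctx) (w : rat) (Q : ctx -> rat -> Prop) :
    Prop :=
  exists G' w1 w2, [/\ Q G' w1, tyI ctx0 w2 V (G' n), w = w1 + w2
    & forall x, x != n -> itype_eq (G' x) (G x)].

Lemma splits_eq n G D w Q : ctx_eq G D -> splits n G w Q -> splits n D w Q.
Proof.
move=> e [G' [w1 [w2 [hQ hV ew eG]]]]; exists G', w1, w2; split=> // x nx.
exact: mset_eq_trans (eG x nx) (e x).
Qed.

Lemma splits_sub n G w (Q Q' : ctx -> rat -> Prop) :
  (forall G w, Q G w -> Q' G w) -> splits n G w Q -> splits n G w Q'.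
Proof.
by move=> sub [G' [w1 [w2 [/sub hQ hV ew eG]]]]; exists G', w1, w2.
Qed.

Lemma splits_up n m G w Q (Q' : ctx -> rat -> Prop) :
  (forall G' G w, ctx_eq G' (scons m G) -> Q G' w -> Q' G w) ->
  splits n.+1 (scons m G) w Q -> splits n G w Q'.
Proof.
move=> sub [G' [w1 [w2 [hQ hV ew eG]]]].
exists (fun x => G' x.+1), w1, w2; split=> //; last by move=> x nx; exact: (eG x.+1).
by apply: sub hQ => -[|x] //=; exact: (eG 0%N).
Qed.

Lemma splits_shift n G w c (Q Q' : ctx -> rat -> Prop) :
  (forall G w, Q G w -> Q' G (w + c)) -> splits n G w Q ->
  splits n G (w + c) Q'.
Proof.
move=> sub [G' [w1 [w2 [hQ hV -> eG]]]]; exists G', (w1 + c), w2.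
by split=> //; [exact: sub | rewrite addrAC].
Qed.

Lemma splits_add n G D w v Q Q' (Q2 : ctx -> rat -> Prop) :
  (forall G w D v, Q G w -> Q' D v -> Q2 (ctx_add G D) (w + v)) ->
  splits n G w Q -> splits n D v Q' -> splits n (ctx_add G D) (w + v) Q2.
Proof.
move=> sub [G' [w1 [w2 [hQ hV -> eG]]]] [D' [v1 [v2 [hQ' hV' -> eD]]]].
exists (ctx_add G' D'), (w1 + v1), (w2 + v2); rewrite addrACA; split=> //.
- exact: sub.
- exact: tyI_cat.
- by move=> x nx; apply: mset_eq_cat => //; [exact: eG | exact: eD].
Qed.

Lemma splits_sum n k (p : 'I_k -> rat) (G : 'I_k -> ctx) (w : 'I_k -> rat)
    (Q : 'I_k -> ctx -> rat -> Prop) (Q' : ctx -> rat -> Prop) :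
  (forall i, coef_ok (p i)) ->
  (forall G w, (forall i, Q i (G i) (w i)) ->
     Q' (ctx_sum (fun i => ctx_scale (p i) (G i))) (\sum_(i < k) p i * w i)) ->
  (forall i, splits n (G i) (w i) (Q i)) ->
  splits n (ctx_sum (fun i => ctx_scale (p i) (G i))) (\sum_(i < k) p i * w i) Q'.
Proof.
move=> hp sub /fin_all_exists[G' /fin_all_exists[w1 /fin_all_exists[w2 h]]].
exists (ctx_sum (fun i => ctx_scale (p i) (G' i))),
  (\sum_(i < k) p i * w1 i), (\sum_(i < k) p i * w2 i); split.
- by apply: sub => i; case: (h i).
- by apply: tyI_sum => // i; case: (h i).
- rewrite -big_split /=; apply: eq_bigr => i _.
  by rewrite -mulrDr; case: (h i) => _ _ ->.
- move=> x nx; apply: mset_eq_flatten => // i; apply: mset_eq_scale.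
  by case: (h i) => _ _ _; exact.
Qed.

Lemma splits_var n G w m : tyI G w V m ->
  splits n G w (fun G w => tyI G w (Var n) m).
Proof.
move=> h; exists (ctx1 n m), 0, w; split.
- by apply: ty_var; case: (ty_wf.2.1 _ _ _ _ h).
- rewrite /ctx1 eqxx; apply: tyI_ctx (h) => x.
  by rewrite (ty_relevant.2.1 _ _ _ _ h 0%N).
- by rewrite add0r.
- by move=> x nx; rewrite /ctx1 (negPf nx) (ty_relevant.2.1 _ _ _ _ h 0%N).
Qed.

(** [Var n] is excluded in the first part because a variable has no arrow typing of its own, only
    intersection types. An occurrence of [n] is thus resolved at the intersection level, where the
    whole typing of [V] is handed over by [splits_var]. *)
Lemma antisubst :
  (forall G w V0 A, tyA G w V0 A -> forall n U, vclosed_at n.+1 U ->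
     V0 = vsubst (subst_at n V) U -> U <> Var n ->
     splits n G w (fun G w => tyA G w U A)) /\
  (forall G w V0 m, tyI G w V0 m -> forall n U, vclosed_at n.+1 U ->
     V0 = vsubst (subst_at n V) U ->
     splits n G w (fun G w => tyI G w U m)) /\
  (forall G w M0 b, tyD G w M0 b -> forall n M, tclosed_at n.+1 M ->
     M0 = tsubst (subst_at n V) M ->
     splits n G w (fun G w => tyD G w M b)).
Proof.
apply: ty_ind.
- move=> G w M0 m b _ IH n [x|M] cM /=; rewrite /subst_at.
    by case: eqP => // -> _.
  move=> [eM] _; rewrite (tsubst_up_at _ cV cM) in eM.
  apply: (splits_shift (Q := fun G w => tyD (scons m G) w M b)).
    by move=> G1 v; exact: ty_lam.
  by apply: splits_up (IH _ _ cM eM) => G1 D u e; exact: tyD_ctx e.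
- move=> G G' w V0 A A' eG eA _ IH n U cU eU nU.
  apply: splits_eq eG _; apply: splits_sub (IH _ _ cU eU nU) => D v.
  exact: tyA_eq.
- move=> x m wm n [y|M] cU //=; rewrite /subst_at; case: eqP => [-> eV|ny [exy]].
    by apply: splits_var; rewrite -eV; exact: ty_var.
  rewrite -exy in ny *; exists (ctx1 x m), 0, 0; rewrite addr0.
  split=> //; first exact: ty_var.
  by rewrite /ctx1; case: eqP => [e|_]; [case: ny | exact: tyI_nil].
- move=> k q G w V0 A hq hA IH n U cU eU.
  have [U_n|nU] : U = Var n \/ U <> Var n.
    by case: U {cU eU} => [y|M]; [case: (eqVneq y n) => [->|/eqP ny]|]; [left|right; case|right].
    rewrite U_n in eU *; apply: splits_var.
    by move: eU; rewrite /= /subst_at eqxx => <-; exact: ty_bang.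
  apply: splits_sum (hq) _ (fun i => IH i n U cU eU nU).
  by move=> G' w' h; exact: ty_bang hq h.
- move=> G G' w V0 m m' eG em _ IH n U cU eU.
  apply: splits_eq eG _; apply: splits_sub (IH _ _ cU eU) => D v.
  exact: tyI_eq.
- move=> M0 n M _ _; exists ctx0, 0, 0; rewrite addr0; split=> //.
    exact: ty_zero.
  exact: tyI_nil.
- move=> G D w v V1 V2 m b _ IH1 _ IH2 n [|U1 U2||] //= /andP[c1 c2] [e1 e2].
  apply: splits_add (IH1 _ _ c1 e1) (IH2 _ _ c2 e2) => G' w' D' v'.
  exact: ty_app.
- move=> G D w v M1 M2 a b _ IH1 _ IH2 n [||N1 N2|] //= /andP[c1 c2] [e1 e2].
  have [G' [w1 [w2 [h1 hV1 -> eG]]]] := IH1 _ _ c1 e1.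
  have [D' [v1 [v2 [h2 hV2 -> eD]]]] := IH2 _ _ c2 e2.
  exists (ctx_add (ctx_scale 2^-1 G') (ctx_scale 2^-1 D')),
    (2^-1 * w1 + 2^-1 * v1 + 1), (2^-1 * w2 + 2^-1 * v2); split.
  + exact: ty_oplus.
  + by apply: tyI_cat => //; apply: tyI_scale.
  + by ring.
  + by move=> x nx; apply: mset_eq_cat => //; apply: mset_eq_scale; [exact: eG | exact: eD].
- move=> k p m D w b G v N0 M0 hN IHN _ IHM n [|||N M] //= /andP[cN cM] [eN eM].
  rewrite (tsubst_up_at _ cV cM) in eM.
  have hp : forall i, coef_ok (p i).
    by have [/andP[/coefs_wf_ord[]]] := ty_wf.2.2 _ _ _ _ hN.
  have sM i : splits n (D i) (w i) (fun G w => tyD (scons (m i) G) w M (b i)).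
    by apply: splits_up (IHM i _ _ cM eM) => G1 G2 u e; exact: tyD_ctx e.
  apply: (splits_shift (Q := fun G w => tyD G (w + 1) (Let N M) _)).
    by move=> G1 w1; exact.
  (* The branches alone do not form a judgement, so the intermediate predicate keeps the family of
     their typings until the typing of [N] joins them. *)
  rewrite (addrC _ v); apply: splits_add (IHN _ _ cN eN) (splits_sum
    (Q' := fun G w => exists D' w', [/\ G = ctx_sum (fun i => ctx_scale (p i) (D' i)),
        w = \sum_(i < k) p i * w' i
      & forall i, tyD (scons (m i) (D' i)) (w' i) M (b i)]) hp _ sM).
    move=> G1 w1 _ _ hN1 [D' [w' [-> -> hM]]]; rewrite (addrC w1).
    exact: ty_let hN1 hM.
  by move=> D' w' hM; exists D', w'.
- by move=> G w V0 m _ IH n [U|||] //= cU [eU]; apply: splits_sub (IH _ _ cU eU) => D v; exact: ty_val.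
- move=> G G' w M0 a a' eG ea _ IH n M cM eM.
  apply: splits_eq eG _; apply: splits_sub (IH _ _ cM eM) => D v.
  exact: tyD_eq.
Qed.

End AntiSubstitution.

(** * Completeness *)

Lemma ty_let_closed M N v a w b : tyD ctx0 v N a ->
  bindR (fun w m b => tyD (scons m ctx0) w M b) w a b ->
  tyD ctx0 (w + v + 1) (Let N M) b.
Proof.
move=> hN /bindR_ord_inv[n [p [m [w' [b' [ea -> -> h]]]]]]; rewrite ea in hN.
by apply: tyD_ctx (ty_let hN h) => x; rewrite /ctx_add ctx_nil_sum.
Qed.

Lemma ty_let_inv G w N M b : closed_term (Let N M) -> tyD G w (Let N M) b ->
  (w = 0 /\ b = [::]) \/ exists v a w' b',
    [/\ tyD ctx0 v N a, bindR (fun w m b => tyD (scons m ctx0) w M b) w' a b',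
        w = w' + v + 1 & dtype_eq b' b].
Proof.
rewrite /closed_term /= => /andP[cN cM].
move eL: (Let N M) => L h; elim: h eL => // {G w L b}.
- by move=> ? _; left.
- move=> n p m D w b G v N0 M0 hN _ hM _ [eN eM]; rewrite -eN -eM in hN hM *.
  right; exists v, [seq (p k, m k) | k : 'I_n], (\sum_(k < n) p k * w k),
    (flatten [seq mscale (p k) (b k) | k : 'I_n]); split=> //.
    by apply: tyD_ctx (hN) => x; rewrite (ty_relevant.2.2 _ _ _ _ hN 0%N).
  apply: (bindR_ord (P := fun w m b => tyD (scons m ctx0) w M b)) => k.
  apply: (tyD_ctx _ (hM k)) => -[|x] //=.
  by have /= -> := ty_relevant.2.2 _ _ _ _ (hM k) 1%N x.+1 cM isT.
- move=> G G' w L a a' _ ea _ IH /IH[[-> a0]|[v [b [w' [b' [hN hM ew eb]]]]]].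
    left; split=> //; apply/nilP; by rewrite -(mset_eq_nilp ea) a0.
  by right; exists v, b, w', b'; split=> //; exact: mset_eq_trans eb ea.
Qed.

(** The distributions of the reducts of [N] are joined into one, and so are the typings of [M],
    ready for a single let. A branch typed by rule (let) contributes its probability to [w] through
    the 1 of that rule; a branch typed by (Zero) contributes nothing, whence only an inequality. *)
Lemma ty_let_branches_inv M (ms : seq (rat * tm)) w a : tclosed_at 1 M ->
  all (fun x => closed_term x.2) ms -> all (fun x => 0 < x.1) ms ->
  bindR (tyD ctx0) w [seq (x.1, Let x.2 M) | x <- ms] a ->
  exists v aN w' b, [/\ bindR (tyD ctx0) v ms aN,
    bindR (fun w m b => tyD (scons m ctx0) w M b) w' aN b, dtype_eq b a
    & w <= v + w' + mass ms].
Proof.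
move=> cM; elim: ms w a => [|[p N] ms IH] w a /=.
  move=> _ _ /bindR_nil_inv[-> ->]; exists 0, [::], 0, [::].
  by rewrite /mass big_nil; split; try exact: bindR_nil.
move=> /andP[cN cms] /andP[p0 ms0].
move=> h; have [w1 [a1 [w2 [a2 [h1 h2 -> ->]]]]] := bindR_cons_inv h.
have [v [aN [w' [b [hv hb eb le_w2]]]]] := IH _ _ cms ms0 h2.
have [v1 [aN1 [w1' [b1 [hv1 hb1 eb1 le_w1]]]]] : exists v aN w' b,
    [/\ tyD ctx0 v N aN, bindR (fun w m b => tyD (scons m ctx0) w M b) w' aN b,
     dtype_eq b a1 & w1 <= v + w' + 1].
  have [|[-> ->]|[v1 [aN1 [w1' [b1 [hv1 hb1 -> eb1]]]]]] := @ty_let_inv _ _ N M _ _ h1.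
  - by rewrite /closed_term /= cM andbT.
  (* A branch typed by (Zero): its reduct of [N] gets the empty distribution, so no typing of [M] is
     called for. *)
  - exists 0, [::], 0, [::]; split=> //; first exact: ty_zero.
    exact: bindR_nil.
  - by exists v1, aN1, w1', b1; split=> //; rewrite (addrC v1).
exists (p * v1 + v), (mscale p aN1 ++ aN), (p * w1' + w'), (mscale p b1 ++ b).
split.
- exact: bindR_cons.
- exact: bindR_cat (bindR_scale p hb1) hb.
- by apply: mset_eq_cat => //; exact: mset_eq_scale.
have le_pw1 : p * w1 <= p * (v1 + w1' + 1) by rewrite ler_pM2l.
by move: le_pw1 le_w2; rewrite /mass big_cons /= !mulrDr mulr1; lra.
Qed.

Lemma ty_redex M V w a : tclosed_at 1 M -> vclosed_at 0 V ->
  tyD ctx0 w (subst1 M V) a ->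
  exists m w1 w2, [/\ tyD (scons m ctx0) w1 M a, tyI ctx0 w2 V m & w = w1 + w2].
Proof.
move=> cM cV h.
have eM : subst1 M V = tsubst (subst_at 0 V) M.
  by apply: (subst_ext.2 _ _ _ _ cM) => -[].
have [G [w1 [w2 [hM hV -> eG]]]] := (antisubst cV).2.2 _ _ _ _ h 0%N _ cM eM.
exists (G 0%N), w1, w2; split=> //; apply: tyD_ctx hM => -[|x] //=.
exact: eG.
Qed.

(** The gained 1 is the one charged by the rule for the abstraction, the let or the choice that is
    contracted. Inside a let it comes from the induction hypothesis, while the 1 of the enclosing
    let covers the 1s of the branches, whose probabilities sum to 1. *)
Lemma expansion M ms w a : closed_term M -> red (F := rat) M ms ->
  bindR (tyD ctx0) w ms a -> exists2 w', tyD ctx0 w' M a & w + 1 <= w'.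
Proof.
rewrite /closed_term => cM r; elim: r w a cM => {M ms}.
- move=> M V w a /= /andP[cM cV] h0; have [w0 [a0 [h -> ->]]] := bindR_one_inv h0.
  rewrite mscale1 mul1r; have [m [w1 [w2 [hM hV ->]]]] := ty_redex cM cV h.
  exists (w1 + 1 + w2); last by rewrite addrAC.
  have hL : tyI ctx0 (w1 + 1) (Lam M) [:: (1, Arr m a0)].
    apply/tyI_typings => //; have hA := ty_lam hM; split.
      by rewrite /coefs_wf all_seq1 (ty_wf.1 _ _ _ _ hA).1.
    by rewrite -[w1 + 1]mul1r; apply: (@bindR_one _ _ _ 1 _ _ [::]).
  exact: tyD_ctx (ty_app hL hV).
- move=> V M w a /= /andP[cV cM] h0; have [w0 [a0 [h -> ->]]] := bindR_one_inv h0.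
  rewrite mscale1 mul1r; have [m [w1 [w2 [hM hV ->]]]] := ty_redex cM cV h.
  exists (w1 + w2 + 1) => //; apply: ty_let_closed (ty_val hV) _.
  by rewrite -[w1]mul1r -[a0]mscale1; exact: bindR_one.
- move=> M N w a _ h; have [w1 [a1 [v [b [h1 h0 -> ->]]]]] := bindR_cons_inv h.
  have [w2 [a2 [h2 -> ->]]] := bindR_one_inv h0.
  exists (2^-1 * w1 + 2^-1 * w2 + 1) => //.
  exact: tyD_ctx (ty_oplus h1 h2).
move=> N M ms /redP st IH w a /= /andP[cN cM].
move=> h; have [v [aN [w' [b [hv hb eb]]]]] :=
  ty_let_branches_inv cM (step_closed cN st) (step_gt0 st) h.
rewrite (step_mass st) => le_w.
have [v' hN le_v] := IH _ _ cN hv.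
exists (w' + v' + 1); last by lra.
exact: tyD_eq eb (ty_let_closed hN hb).
Qed.

Lemma tight_typing_ge k M : closed_term M ->
  exists w a, [/\ tight_typing w M a, Ek rat k M <= w & Pk rat k M <= mass a].
Proof.
have val V j : closed_term (Val V) -> exists w a,
    [/\ tight_typing w (Val V) a, Ek rat j (Val V) <= w & Pk rat j (Val V) <= mass a].
  (* The empty instance of (!) types a value at norm 1 and weight 0, which match P_j = 1 and E_j =
     0. *)
  move=> cV; exists 0, [:: (1, [::])]; rewrite Ek_val Pk_val /mass big_cons big_nil.
  by split=> //; split=> //; apply: ty_val; exact: tyI_nil.
elim: k M => [|k IH] M cM.
  have [/negbTE vM|] := boolP (~~ is_value M); last by case: M cM => // V cV _; exact: val.
  (* At stage 0 a non-value has P_0 = E_0 = 0, for which (Zero) is enough. *)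
  exists 0, [::]; rewrite /Ek big_ord0 Pk0 vM /mass big_nil; split=> //.
  by split=> //; exact: ty_zero.
have [nM|] := boolP (~~ is_value M); last by case: M cM => // V cV _; exact: val.
have [ms st] := @step_progress rat M cM nM.
have [w [a [h ta le_w le_a]]] : exists w a,
    [/\ bindR (tyD ctx0) w ms a, tight a,
      \sum_(x <- ms) x.1 * Ek rat k x.2 <= w
    & \sum_(x <- ms) x.1 * Pk rat k x.2 <= mass a].
  move: (step_closed cM st) (step_gt0 st) => {st}; elim: ms => [|[p N] ms IHms] /=.
    by exists 0, [::]; rewrite /mass !big_nil; split=> //; exact: bindR_nil.
  move=> /andP[/IH[w1 [a1 [[h1 ta1] le_w1 le_a1]]] cms] /andP[p0 pms].
  have [w2 [a2 [h2 ta2 le_w2 le_a2]]] := IHms cms pms.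
  exists (p * w1 + w2), (mscale p a1 ++ a2).
  rewrite !big_cons mass_cat mass_scale !lerD ?ler_pM2l //; split=> //.
    exact: bindR_cons.
  rewrite /tight all_cat; apply/andP; split=> //.
  by rewrite all_map.
have [w' h' le_w'] := expansion cM ((redP _ _).2 st) h.
exists w', a; rewrite (EkS _ st) (PkS_step _ st); split=> //.
by apply: le_trans le_w'; rewrite addrC lerD2r.
Qed.

Lemma ereal_sup_eq_dominating (R : realType) (A B : set (\bar R)) :
  (forall x, A x -> exists2 y, B y & (x <= y)%E) ->
  (forall y, B y -> exists2 x, A x & (y <= x)%E) ->
  ereal_sup A = ereal_sup B.
Proof.
move=> AB BA; apply/eqP; rewrite eq_le; apply/andP; split.
  by apply: ge_ereal_sup => x /AB; exact: le_ereal_sup_tmp.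
by apply: ge_ereal_sup => y /BA; exact: le_ereal_sup_tmp.
Qed.

Theorem mainTheorem11 (R : realType) (M : tm) (closedM : closed_term M) :
  prob_term R M =
    ereal_sup [set (ratr (mass a) : R)%:E
              | a in [set a : dtype | exists w : rat, tight_typing w M a]] /\
  exp_time R M =
    ereal_sup [set (ratr w : R)%:E
              | w in [set w : rat | exists a : dtype, tight_typing w M a]].
Proof.
split; apply: ereal_sup_eq_dominating.
- move=> _ [k _ <-]; have [w [a [h _ le_a]]] := tight_typing_ge k closedM.
  exists (ratr (mass a))%:E; first by exists a => //; exists w.
  by rewrite Pk_ratr lee_fin ler_rat.
- move=> _ [a [w h] <-]; have [k [_ le_a]] := soundness closedM h.
  exists (Pk R k M)%:E; first by exists k.
  by rewrite Pk_ratr lee_fin ler_rat.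
- move=> _ [k _ <-]; have [w [a [h le_w _]]] := tight_typing_ge k closedM.
  exists (ratr w)%:E; first by exists w => //; exists a.
  by rewrite Ek_ratr lee_fin ler_rat.
- move=> _ [w [a h] <-]; have [k [le_w _]] := soundness closedM h.
  exists (Ek R k M)%:E; first by exists k.
  by rewrite Ek_ratr lee_fin ler_rat.
Qed.
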